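(* Let $\mathcal{C}$ be a graded poset with a decreasing degree function $\deg$ and let $F:\mathcal{C}\rightarrow \mathrm{Ab}$ be a functor. Then: (i) There exists a cohomological type spectral sequence $E^{*,*}_*$ with target $\mathrm{colim}_* F$ (the left derived functors of $\mathrm{colim}:\mathrm{Ab}^{\mathcal{C}}\to\mathrm{Ab}$ evaluated at $F$), namely the one associated with the decreasing filtration $L^*$ of $C_*(\mathcal{C},F)$ by the degree of the final object of simplices. (ii) For each $p$ there exists a homological type spectral sequence $(E^p)^*_{*,*}$ with target the column $E^{p,*}_1$ of the first page of the spectral sequence in (i), namely the one associated with the increasing filtration of $L^p/L^{p+1}$ by the degree of the initial object of simplices.
   Context: $\mathrm{Ab}$ is the category of abelian groups. A poset $\mathcal{P}$ is regarded as a category with exactly one arrow $p\to p'$ if $p\le p'$. For $p<p'$, $p$ precedes $p'$ if $p\le p''\le p'$ implies $p''=p$ or $p''=p'$. A decreasing degree function on $\mathcal{P}$ is a function $\deg:\mathrm{Ob}(\mathcal{P})\to\mathbb{Z}$ which is strictly order reversing ($p<p'$ implies $\deg(p)>\deg(p')$) and such that $\deg(p')=\deg(p)-1$ whenever $p$ precedes $p'$. A graded poset is a poset admitting a decreasing degree function (equivalently, taking negatives, an increasing one). For a small category $\mathcal{C}$ and a functor $F:\mathcal{C}\to\mathrm{Ab}$, let $N\mathcal{C}$ be the nerve, with $n$-simplices $\sigma=(\sigma_0\xrightarrow{\alpha_1}\sigma_1\to\cdots\xrightarrow{\alpha_n}\sigma_n)$, and let $C_n(\mathcal{C},F)=\bigoplus_{\sigma\in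 N\mathcal{C}_n}F_\sigma$ with $F_\sigma=F(\sigma_0)$. This is a simplicial abelian group with faces and degeneracies induced from $N\mathcal{C}$ ($d_0$ uses $F(\alpha_1)$). With $d=\sum_{i=0}^n(-1)^id_i$, the complex $(C_*(\mathcal{C},F),d)$ has homology $H_i(C_*(\mathcal{C},F))=\mathrm{colim}_iF$. First filtration: $L^pC_n(\mathcal{C},F)=\bigoplus_{\sigma\in N\mathcal{C}_n,\ \deg(\sigma_n)\ge p}F_\sigma$, a decreasing filtration by subcomplexes. Its spectral sequence is graded cohomologically by $C^{-n}=C_n$, so that $E_1^{p,q}\cong H^{p+q}(L^p/L^{p+1})$, where $L^p/L^{p+1}$ is the complex of the simplicial abelian group with $n$-simplices $\bigoplus_{\sigma\in N\mathcal{C}_n,\ \deg(\sigma_n)=p}F_\sigma$. Second filtration: for each $p$, $L^p/L^{p+1}$ is filtered increasingly by the subcomplexes spanned by the summands with $\deg(\sigma_0)\le p'$. A spectral sequence is of cohomological (resp. homological) type if its differential on the $r$-th page has bidegree $(r,1-r)$ (resp. $(-r,r-1)$). ''Target $H$'' means that the spectral sequence is the one associated with a filtered differential graded abelian group whose (co)homology is $H$, up to the evident reindexing of total degree; no strong convergence is asserted. *)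

(* Defs.v *)
From HB Require Import structures.
From mathcomp Require Import all_boot all_order all_algebra.
From mathcomp Require Import zify.
From mathcomp Require Import boolp classical_sets cardinality fsbigop.

Set Implicit Arguments.
Unset Strict Implicit.
Unset Printing Implicit Defensive.

Import Order.TTheory GRing.Theory Num.Theory.

Local Open Scope ring_scope.
Local Open Scope quotient_scope.

Definition isomorphic (A B : zmodType) : Prop :=
  exists f : {additive A -> B}, bijective f.

Section Subgroups.
Variables (A A' : zmodType) (f : {additive A -> A'}).

Definition full_pred : {pred A} := xpredT.
Fact full_pred_closed : zmod_closed full_pred. Proof. by []. Qed.
HB.instance Definition _ := GRing.isZmodClosed.Build A full_pred full_pred_closed.

Definition ker_pred : {pred A} := [pred x | f x == 0].
Fact ker_pred_closed : zmod_closed ker_pred.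
Proof.
split=> [|x y]; rewrite !inE ?raddf0 ?eqxx // => /eqP fx /eqP fy.
by rewrite raddfB fx fy subrr.
Qed.
HB.instance Definition _ := GRing.isZmodClosed.Build A ker_pred ker_pred_closed.

Definition im_pred : {pred A'} := [pred y | `[< exists x, f x = y >]].
Lemma im_predP y : reflect (exists x, f x = y) (y \in im_pred).
Proof. exact: asboolP. Qed.
Fact im_pred_closed : zmod_closed im_pred.
Proof.
split=> [|_ _ /im_predP[a <-] /im_predP[b <-]]; apply/im_predP.
  by exists 0; rewrite raddf0.
by exists (a - b); rewrite raddfB.
Qed.
HB.instance Definition _ := GRing.isZmodClosed.Build A' im_pred im_pred_closed.

Definition preim_pred (S : zmodClosed A') : {pred A} := [pred x | f x \in S].
Fact preim_pred_closed S : zmod_closed (preim_pred S).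
Proof.
by split=> [|x y hx hy]; rewrite unfold_in /= ?raddf0 ?rpred0 // raddfB rpredB.
Qed.
HB.instance Definition _ S :=
  GRing.isZmodClosed.Build A (preim_pred S) (preim_pred_closed S).

Definition span_pred (S : {pred A}) : {pred A} :=
  [pred x | `[< forall G : zmodClosed A, {subset S <= G} -> x \in G >]].
Lemma span_predP S x :
  reflect (forall G : zmodClosed A, {subset S <= G} -> x \in G) (x \in span_pred S).
Proof. exact: asboolP. Qed.
Fact span_pred_closed S : zmod_closed (span_pred S).
Proof.
split=> [|x y /span_predP hx /span_predP hy]; apply/span_predP => G SG.
  exact: rpred0.
by rewrite rpredB ?hx ?hy.
Qed.
HB.instance Definition _ S :=
  GRing.isZmodClosed.Build A (span_pred S) (span_pred_closed S).

End Subgroups.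
Arguments full_pred A : clear implicits.

Section Subquotient.
Variables (A : zmodType) (Z B : zmodClosed A).

Definition subgrp := {x : A | x \in Z}.
HB.instance Definition _ := SubChoice.on subgrp.
HB.instance Definition _ := [SubChoice_isSubZmodule of subgrp by <:].

Definition subgrp_pred : {pred subgrp} := [pred u | val u \in B].
Fact subgrp_pred_closed : zmod_closed subgrp_pred.
Proof.
split=> [|x y]; rewrite !inE ?raddf0 ?rpred0 // => hx hy.
by rewrite raddfB rpredB.
Qed.
HB.instance Definition _ :=
  GRing.isZmodClosed.Build subgrp subgrp_pred subgrp_pred_closed.

(* [Z / (Z :&: B)]; in every use below [B] is contained in [Z]. *)
Definition subquot : zmodType := Quotient.quot subgrp_pred.

Definition subquot_pi : {additive subgrp -> subquot} :=
  \pi_(Quotient.quot subgrp_pred).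

(* The class of [x], meaningful for [x \in Z] only (and [0] otherwise). *)
Definition cls (x : A) : subquot := subquot_pi (insubd 0 x).

Lemma clsE (u : subgrp) : cls (val u) = subquot_pi u.
Proof. by rewrite /cls valKd. Qed.

Lemma cls_surj (y : subquot) : exists2 x, x \in Z & y = cls x.
Proof. by exists (val (repr y)); [exact: valP | rewrite -{1}[y]reprK clsE]. Qed.

Lemma clsB (x y : A) : x \in Z -> y \in Z -> cls (x - y) = cls x - cls y.
Proof.
move=> xZ yZ; rewrite /cls -raddfB; congr (subquot_pi _).
by apply: val_inj; rewrite raddfB /= !insubdK // -topredE /= ?rpredB.
Qed.

Lemma cls_eq0 (x : A) : x \in Z -> (cls x == 0) = (x \in B).
Proof.
move=> xZ; rewrite /cls -(raddf0 subquot_pi) -Quotient.idealrBE subr0.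
by rewrite inE insubdK.
Qed.

End Subquotient.

Section SubquotientMaps.
Variables (A A' : zmodType) (Z B : zmodClosed A) (Z' B' : zmodClosed A').
Variable f : {additive A -> A'}.
Hypothesis fZ : forall x, x \in Z -> f x \in Z'.
Hypothesis fB : forall x, x \in Z -> x \in B -> f x \in B'.

Definition subquot_map_fun (y : subquot Z B) : subquot Z' B' :=
  cls Z' B' (f (val (repr y))).

Lemma subquot_map_fun_cls x :
  x \in Z -> subquot_map_fun (cls Z B x) = cls Z' B' (f x).
Proof.
move=> xZ; set u : subgrp Z := repr (cls Z B x).
have uZ : val u \in Z by exact: valP.
have uE : cls Z B (val u) = cls Z B x by rewrite clsE [LHS]reprK.
apply/eqP; rewrite -subr_eq0 -clsB ?fZ // -raddfB.
rewrite cls_eq0; last by rewrite fZ ?rpredB.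
have uxZ := rpredB uZ xZ.
by apply: fB => //; rewrite -(cls_eq0 _ uxZ) clsB // uE subrr.
Qed.

Fact subquot_map_is_additive : zmod_morphism subquot_map_fun.
Proof.
move=> y1 y2; have [x1 x1Z ->] := cls_surj y1; have [x2 x2Z ->] := cls_surj y2.
by rewrite -clsB // !subquot_map_fun_cls ?rpredB // raddfB clsB ?fZ.
Qed.
HB.instance Definition _ :=
  GRing.isZmodMorphism.Build (subquot Z B) (subquot Z' B') subquot_map_fun
    subquot_map_is_additive.

Definition subquot_map : {additive subquot Z B -> subquot Z' B'} :=
  subquot_map_fun.

Lemma subquot_mapE x : x \in Z -> subquot_map (cls Z B x) = cls Z' B' (f x).
Proof. exact: subquot_map_fun_cls. Qed.

End SubquotientMaps.

Section SubquotientImage.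
Variables (A : zmodType) (Z B S : zmodClosed A).

Definition subquot_img_pred : {pred subquot Z B} :=
  [pred y | `[< exists x, [/\ x \in Z, x \in S & y = cls Z B x] >]].
Arguments subquot_img_pred : clear implicits.
Lemma subquot_img_predP y :
  reflect (exists x, [/\ x \in Z, x \in S & y = cls Z B x])
          (y \in subquot_img_pred).
Proof. exact: asboolP. Qed.
Fact subquot_img_pred_closed : zmod_closed subquot_img_pred.
Proof.
split=> [|_ _ /subquot_img_predP[a [aZ aS ->]] /subquot_img_predP[b [bZ bS ->]]].
  apply/subquot_img_predP; exists 0; rewrite !rpred0; split=> //.
  by apply/esym/eqP; rewrite cls_eq0 rpred0.
by apply/subquot_img_predP; exists (a - b); rewrite !rpredB // clsB.
Qed.
HB.instance Definition _ :=
  GRing.isZmodClosed.Build (subquot Z B) subquot_img_pred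
    subquot_img_pred_closed.

End SubquotientImage.
Arguments subquot_img_pred {A} Z B S.

(* [ker g / im f], for [g \o f = 0]. *)
Definition homology (A B C : zmodType)
    (f : {additive A -> B}) (g : {additive B -> C}) : zmodType :=
  subquot (ker_pred g) (im_pred f).

Section DirectSum.
Variables (I : choiceType) (A : I -> zmodType).

Definition dprod := forall i, A i.
HB.instance Definition _ := Choice.on dprod.

Definition dprod_add (x y : dprod) : dprod := fun i => x i + y i.
Definition dprod_opp (x : dprod) : dprod := fun i => - x i.
Definition dprod_zero : dprod := fun i => 0.
Fact dprod_addA : associative dprod_add.
Proof. by move=> x y z; apply: functional_extensionality_dep => i; exact: addrA. Qed.
Fact dprod_addC : commutative dprod_add.
Proof. by move=> x y; apply: functional_extensionality_dep => i; exact: addrC. Qed.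
Fact dprod_add0 : left_id dprod_zero dprod_add.
Proof. by move=> x; apply: functional_extensionality_dep => i; exact: add0r. Qed.
Fact dprod_addN : left_inverse dprod_zero dprod_opp dprod_add.
Proof. by move=> x; apply: functional_extensionality_dep => i; exact: addNr. Qed.
HB.instance Definition _ :=
  GRing.isZmodule.Build dprod dprod_addA dprod_addC dprod_add0 dprod_addN.

Definition fin_supp : {pred dprod} :=
  [pred x : dprod | `[< finite_set [set i | x i != 0] >]].
Lemma fin_suppP (x : dprod) :
  reflect (finite_set [set i | x i != 0]) (x \in fin_supp).
Proof. exact: asboolP. Qed.
Fact fin_supp_closed : zmod_closed fin_supp.
Proof.
split=> [|x y /fin_suppP hx /fin_suppP hy]; apply/fin_suppP.
  by apply: (@sub_finite_set _ _ set0) => // i /=; rewrite eqxx.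
apply: (@sub_finite_set _ _ ([set i | x i != 0] `|` [set i | y i != 0])%classic).
  move=> i /= xyi; have [x0|] := eqVneq (x i) 0; last by left.
  right; apply: contra_neq xyi => y0.
  by rewrite [LHS](_ : _ = x i - y i) // x0 y0 subrr.
by rewrite finite_setU.
Qed.
HB.instance Definition _ := GRing.isZmodClosed.Build dprod fin_supp fin_supp_closed.

(* The direct sum of the [A i], as finitely supported families. *)
Definition dsum : zmodType := subgrp fin_supp.

Definition dsum_coord (i : I) (x : dsum) : A i := val x i.
Fact dsum_coord_is_additive i : zmod_morphism (@dsum_coord i).
Proof. by []. Qed.
HB.instance Definition _ i :=
  GRing.isZmodMorphism.Build dsum (A i) (@dsum_coord i)
    (@dsum_coord_is_additive i).

Lemma dsumP (x y : dsum) : (forall i, dsum_coord i x = dsum_coord i y) -> x = y.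
Proof.
by move=> xy; apply: val_inj; apply: functional_extensionality_dep => i; exact: xy.
Qed.

Definition dsum_in_fun (i : I) (a : A i) : dprod :=
  fun j => if @eqP _ i j is ReflectT e then ecast k (A k) e a else 0.
Fact dsum_in_fin_supp i (a : A i) : dsum_in_fun a \in fin_supp.
Proof.
apply/fin_suppP; apply: (@sub_finite_set _ _ [set i]%classic) => // j /=.
by rewrite /dsum_in_fun; case: eqP => [e _|_]; [exact: esym e | rewrite eqxx].
Qed.
Definition dsum_in (i : I) (a : A i) : dsum :=
  @exist dprod (fun x => x \in fin_supp) _ (dsum_in_fin_supp a).

Lemma dsum_coord_in i (a : A i) : dsum_coord i (dsum_in a) = a.
Proof.
rewrite /dsum_coord /= /dsum_in_fun; case: eqP => // e.
by rewrite eq_axiomK.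
Qed.
Lemma dsum_coord_in_neq i j (a : A i) : i <> j -> dsum_coord j (dsum_in a) = 0.
Proof. by rewrite /dsum_coord /= /dsum_in_fun; case: eqP. Qed.

Fact dsum_in_is_additive i : zmod_morphism (@dsum_in i).
Proof.
move=> a b; apply: dsumP => j; rewrite raddfB /=.
have [e|ij] := pselect (i = j); last by rewrite !dsum_coord_in_neq // subr0.
by case: j / e; rewrite !dsum_coord_in.
Qed.
HB.instance Definition _ i :=
  GRing.isZmodMorphism.Build (A i) dsum (@dsum_in i) (@dsum_in_is_additive i).

(* The subgroup of the families supported in [P], i.e. the partial sum of the
   [A i] with [P i]. *)
Definition supported (P : {pred I}) : {pred dsum} :=
  [pred x | `[< forall i, dsum_coord i x != 0 -> P i >]].
Lemma supportedP (P : {pred I}) (x : dsum) :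
  reflect (forall i, dsum_coord i x != 0 -> P i) (x \in supported P).
Proof. exact: asboolP. Qed.
Fact supported_closed P : zmod_closed (supported P).
Proof.
split=> [|x y /supportedP hx /supportedP hy]; apply/supportedP => i.
  by rewrite raddf0 eqxx.
have [x0|/hx //] := eqVneq (dsum_coord i x) 0.
by rewrite raddfB /= x0 sub0r oppr_eq0; exact: hy.
Qed.
HB.instance Definition _ P :=
  GRing.isZmodClosed.Build dsum (supported P) (supported_closed P).

Section Lift.
Variables (B : zmodType) (g : forall i, {additive A i -> B}).

Definition dsum_lift_fun (x : dsum) : B :=
  \sum_(i \in [set: I]%classic) g i (dsum_coord i x).

Lemma dsum_lift_finE (s : seq I) (x : dsum) : uniq s ->
    (forall i, dsum_coord i x != 0 -> i \in s) ->
  dsum_lift_fun x = \sum_(i <- s) g i (dsum_coord i x).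
Proof.
move=> us xs; rewrite /dsum_lift_fun (fsbigE s) // => [|i _ is'].
  by apply: eq_bigl => i; rewrite in_setT.
by have [->|/xs /(negP is')] := eqVneq (dsum_coord i x) 0; rewrite ?raddf0.
Qed.

Lemma dsum_supp_seq (x : dsum) :
  exists2 s : seq I, uniq s & forall i, dsum_coord i x != 0 -> i \in s.
Proof.
have /fin_suppP/finite_seqP[s sE] := valP x.
exists (undup s); rewrite ?undup_uniq // => i ix; rewrite mem_undup.
by have: [set i | val x i != 0]%classic i by []; rewrite sE.
Qed.

Fact dsum_lift_is_additive : zmod_morphism dsum_lift_fun.
Proof.
move=> x y; have [s us sx] := dsum_supp_seq x; have [t ut ty] := dsum_supp_seq y.
have ust : uniq (undup (s ++ t)) by exact: undup_uniq.
rewrite !(dsum_lift_finE ust) -?sumrB.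
- by apply: eq_bigr => i _; rewrite !raddfB.
- by move=> i /ty it; rewrite mem_undup mem_cat it orbT.
- by move=> i /sx it; rewrite mem_undup mem_cat it.
move=> i; rewrite raddfB /= mem_undup mem_cat.
have [->|/sx -> //] := eqVneq (dsum_coord i x) 0.
by rewrite sub0r oppr_eq0 => /ty ->; rewrite orbT.
Qed.
HB.instance Definition _ :=
  GRing.isZmodMorphism.Build dsum B dsum_lift_fun dsum_lift_is_additive.

Definition dsum_lift : {additive dsum -> B} := dsum_lift_fun.

Lemma dsum_lift_in i (a : A i) : dsum_lift (dsum_in a) = g i a.
Proof.
rewrite [LHS](@dsum_lift_finE [:: i]) // ?big_seq1 ?dsum_coord_in // => j.
rewrite inE; apply: contra_neqT => /eqP ji.
by rewrite dsum_coord_in_neq // => ij; apply: ji.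
Qed.

End Lift.

Lemma dsum_decomp (x : dsum) (s : seq I) : uniq s ->
    (forall i, dsum_coord i x != 0 -> i \in s) ->
  x = \sum_(i <- s) dsum_in (dsum_coord i x).
Proof.
move=> us xs; apply: dsumP => j; rewrite raddf_sum /=.
have [js|js] := boolP (j \in s).
  rewrite (big_rem j) //= dsum_coord_in big1_seq ?addr0 // => i /andP[_].
  by rewrite mem_rem_uniq // inE => /andP[/eqP ij _]; rewrite dsum_coord_in_neq.
rewrite big1_seq => [|i /andP[_ is']].
  by apply/eqP; apply: contraNT js; exact: xs.
by rewrite dsum_coord_in_neq // => ij; rewrite -ij is' in js.
Qed.

Lemma dsum_ext (B : zmodType) (f g : {additive dsum -> B}) :
  (forall i (a : A i), f (dsum_in a) = g (dsum_in a)) -> forall x, f x = g x.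
Proof.
move=> fg x; have [s us xs] := dsum_supp_seq x.
by rewrite (dsum_decomp us xs) !raddf_sum; apply: eq_bigr => i _; exact: fg.
Qed.

Lemma supported_ind (P : {pred I}) (G : zmodClosed dsum) :
    (forall i (a : A i), P i -> dsum_in a \in G) ->
  {subset supported P <= G}.
Proof.
move=> PG x /supportedP xP; have [s us xs] := dsum_supp_seq x.
rewrite (dsum_decomp us xs); apply: rpred_sum => i _.
have [->|/xP Pi] := eqVneq (dsum_coord i x) 0; last exact: PG.
by rewrite raddf0 rpred0.
Qed.

Lemma supported_in (P : {pred I}) i (a : A i) :
  P i -> dsum_in a \in supported P.
Proof.
move=> Pi; apply/supportedP => j.
by have [<- //|ij] := pselect (i = j); rewrite dsum_coord_in_neq ?eqxx.
Qed.

End DirectSum.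

(* On a graded object: differential of degree 1 ([Cohom], cohomological grading)
   or -1 ([Homol]).  On a filtration: decreasing ([Cohom]) or increasing
   ([Homol]).  The two are independent until spectral sequences are formed. *)
Inductive variance := Cohom | Homol.

Definition sgv (v : variance) : int := if v is Cohom then 1 else -1.
Definition opv (v : variance) := if v is Cohom then Homol else Cohom.

Lemma sgv_opv v : sgv (opv v) = - sgv v. Proof. by case: v; rewrite //= opprK. Qed.

Record dgAb (v : variance) := DgAb {
  dg_ob :> int -> zmodType;
  dg_d : forall m m' : int, m + sgv v = m' -> {additive dg_ob m -> dg_ob m'};
  dg_dd : forall (m m' m'' : int) (e : m + sgv v = m') (e' : m' + sgv v = m'') x,
    dg_d e' (dg_d e x) = 0
}.
Arguments dg_d {v} K {m m'} e : rename.

Definition dg_H v (K : dgAb v) (m : int) : zmodType :=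
  homology (dg_d K (subrK (sgv v) m)) (dg_d K (erefl (m + sgv v))).

Record filtration (w : variance) v (K : dgAb v) := Filtration {
  fil :> int -> forall m, zmodClosed (K m);
  fil_mono : forall p m, {subset fil (p + sgv w) m <= fil p m};
  fil_d : forall p (m m' : int) (e : m + sgv v = m') x,
    x \in fil p m -> dg_d K e x \in fil p m'
}.

Arguments fil {w v K} L p m : rename.

(* The bidegree of the differential of the [r]-th page: (r, 1 - r) in the
   cohomological case and (-r, r - 1) in the homological one. *)
Definition bideg (v : variance) (r : nat) : int * int :=
  (sgv v * r%:Z, sgv v * (1 - r%:Z)).

(* Pages are numbered from 0.  [ss_next] identifies the homology of the [r]-th
   page with the page [r.+1]. *)
Record spectral_sequence (v : variance) := SpectralSequence {
  ss_page :> nat -> int * int -> zmodType;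
  ss_d : forall r (a b : int * int), a + bideg v r = b -> {additive ss_page r a -> ss_page r b};
  ss_dd : forall r (a b c : int * int) (e : a + bideg v r = b)
      (e' : b + bideg v r = c) x, ss_d e' (ss_d e x) = 0;
  ss_next : forall r (a : int * int),
    {additive homology (@ss_d r _ _ (subrK (bideg v r) a))
                       (@ss_d r _ _ (erefl (a + bideg v r)%R))
              -> ss_page r.+1 a};
  ss_next_bij : forall r a, bijective (ss_next r a)
}.
Arguments ss_d {v} s {r a b} e.

Section Associated.
Variables (v : variance) (K : dgAb v) (L : filtration v K).

(* [{x \in L^p K^m | d x \in L^(p + r)}], resp. [{x \in L_p K_m | d x \in L_(p - r)}]. *)
Definition cyc_pred (r p m : int) : {pred K m} :=
  [pred x | (x \in L p m) && (dg_d K (erefl (m + sgv v)) x \in L (p + sgv v * r) _)].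
Arguments cyc_pred : clear implicits.
Lemma cyc_predP r p m x :
  reflect (x \in L p m /\
           dg_d K (erefl (m + sgv v)) x \in L (p + sgv v * r) (m + sgv v))
          (x \in cyc_pred r p m).
Proof. exact: andP. Qed.
Fact cyc_closed r p m : zmod_closed (cyc_pred r p m).
Proof.
split=> [|x y /cyc_predP[xL dxL] /cyc_predP[yL dyL]]; apply/cyc_predP.
  by rewrite raddf0 !rpred0.
by rewrite raddfB !rpredB.
Qed.
HB.instance Definition _ r p m :=
  GRing.isZmodClosed.Build (K m) (cyc_pred r p m) (@cyc_closed r p m).

(* [Z_(r-1)^(p+1) + d Z_(r-1)^(p-r+1)] in the cohomological case. *)
Definition bnd_pred (r p m : int) : {pred K m} :=
  [pred x | `[< exists y z,
     [/\ y \in cyc_pred (r - 1) (p + sgv v) m,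
         z \in cyc_pred (r - 1) (p - sgv v * (r - 1)) (m - sgv v)
       & x = y + dg_d K (subrK (sgv v) m) z] >]].
Arguments bnd_pred : clear implicits.
Lemma bnd_predP r p m x :
  reflect (exists y z,
     [/\ y \in cyc_pred (r - 1) (p + sgv v) m,
         z \in cyc_pred (r - 1) (p - sgv v * (r - 1)) (m - sgv v)
       & x = y + dg_d K (subrK (sgv v) m) z]) (x \in bnd_pred r p m).
Proof. exact: asboolP. Qed.
Fact bnd_closed r p m : zmod_closed (bnd_pred r p m).
Proof.
split=> [|x1 x2 /bnd_predP[y1 [z1 [y1c z1c ->]]] /bnd_predP[y2 [z2 [y2c z2c ->]]]].
  by apply/bnd_predP; exists 0, 0; rewrite !rpred0 raddf0 addr0.
apply/bnd_predP; exists (y1 - y2), (z1 - z2); rewrite !rpredB //; split=> //.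
by rewrite raddfB opprD addrACA.
Qed.
HB.instance Definition _ r p m :=
  GRing.isZmodClosed.Build (K m) (bnd_pred r p m) (@bnd_closed r p m).

(* The standard page [Z_r^(p,q) / B_r^(p,q)], where [a = (p, q)]. *)
Definition std_page (r : nat) (a : int * int) : zmodType :=
  subquot (cyc_pred r%:Z a.1 (a.1 + a.2)) (bnd_pred r%:Z a.1 (a.1 + a.2)).

Definition std_cls (r : nat) (a : int * int) (x : K (a.1 + a.2)) : std_page r a :=
  cls (cyc_pred r%:Z a.1 (a.1 + a.2)) (bnd_pred r%:Z a.1 (a.1 + a.2)) x.

(* [E] is the spectral sequence of the filtered object [(K, L)]: its pages are
   the standard ones, its differentials are induced by that of [K], and the
   identification of the next page with the homology of the current one is
   induced by the identity on representatives. *)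
Definition ss_associated (E : spectral_sequence v) : Prop :=
  exists phi : forall r a, {additive std_page r a -> E r a},
  [/\ forall r a, bijective (phi r a),
      forall r (a b : int * int) (e : a + bideg v r = b)
             (e' : a.1 + a.2 + sgv v = b.1 + b.2) x,
        x \in cyc_pred r%:Z a.1 (a.1 + a.2) ->
        ss_d E e (phi r a (std_cls r x)) = phi r b (std_cls r (dg_d K e' x))
    & forall r a x, x \in cyc_pred r.+1%:Z a.1 (a.1 + a.2) ->
        ss_next E r a (cls _ _ (phi r a (std_cls r x)))
        = phi r.+1 a (std_cls r.+1 x)].

End Associated.

Section Regrade.
Variables (v w : variance) (K : dgAb v) (L : filtration w K).

Fact regrade_eq (m m' : int) : m + sgv (opv v) = m' -> - m + sgv v = - m'.
Proof. by move=> <-; rewrite sgv_opv opprD opprK. Qed.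

(* The other grading of the same complex: [regrade K] is [K (- m)] in degree [m]. *)
Definition regrade : dgAb (opv v) :=
  @DgAb (opv v) (fun m => K (- m)) (fun m m' e => dg_d K (regrade_eq e))
    (fun m m' m'' e e' x => dg_dd (regrade_eq e) (regrade_eq e') x).

Definition regrade_fil : filtration w regrade :=
  @Filtration w (opv v) regrade (fun p m => L p (- m))
    (fun p m => @fil_mono _ _ _ L p (- m))
    (fun p m m' e x => @fil_d _ _ _ L p _ _ (regrade_eq e) x).

End Regrade.

Section Graded.
Variables (v w : variance) (K : dgAb v) (L : filtration w K) (p : int).

Let gr_ob m : zmodType := subquot (L p m) (L (p + sgv w) m).

Definition gr_d (m m' : int) (e : m + sgv v = m') : {additive gr_ob m -> gr_ob m'} :=
  subquot_map (fun x => @fil_d _ _ _ L p _ _ e x)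
              (fun x _ => @fil_d _ _ _ L (p + sgv w) _ _ e x).

Lemma gr_dE (m m' : int) (e : m + sgv v = m') x : x \in L p m ->
  gr_d e (cls (L p m) (L (p + sgv w) m) x)
  = cls (L p m') (L (p + sgv w) m') (dg_d K e x).
Proof. exact: subquot_mapE. Qed.

Fact gr_dd (m m' m'' : int) (e : m + sgv v = m') (e' : m' + sgv v = m'') x :
  gr_d e' (gr_d e x) = 0.
Proof.
have [y yL ->] := cls_surj x; rewrite gr_dE // gr_dE; last exact: fil_d.
by rewrite dg_dd; apply/eqP; rewrite cls_eq0 rpred0.
Qed.

(* [L^p / L^(p+1)] for a decreasing filtration. *)
Definition gr : dgAb v := @DgAb v gr_ob gr_d gr_dd.

(* The filtration induced on [gr] by another filtration [D] of [K]. *)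
Variables (u : variance) (D : filtration u K).

Definition gr_fil_pred (p' m : int) : zmodClosed (gr m) :=
  subquot_img_pred (L p m) (L (p + sgv w) m) (D p' m).

Fact gr_fil_mono p' m : {subset gr_fil_pred (p' + sgv u) m <= gr_fil_pred p' m}.
Proof.
move=> _ /subquot_img_predP[x [xL xD ->]]; apply/subquot_img_predP.
by exists x; split=> //; exact: fil_mono xD.
Qed.

Fact gr_fil_d p' (m m' : int) (e : m + sgv v = m') x :
  x \in gr_fil_pred p' m -> dg_d gr e x \in gr_fil_pred p' m'.
Proof.
move=> /subquot_img_predP[y [yL yD ->]]; apply/subquot_img_predP.
by exists (dg_d K e y); rewrite !fil_d //; split=> //; exact: gr_dE.
Qed.

Definition gr_fil : filtration u gr :=
  @Filtration u v gr gr_fil_pred gr_fil_mono gr_fil_d.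

End Graded.

Record chain := Chain {
  ch_ob :> nat -> zmodType;
  ch_d : forall n, {additive ch_ob n.+1 -> ch_ob n};
  ch_dd : forall n x, ch_d n (ch_d n.+1 x) = 0
}.
Arguments ch_d X n : rename.

Record chain_filtration (w : variance) (X : chain) := ChainFiltration {
  ch_fil :> int -> forall n, zmodClosed (X n);
  ch_fil_mono : forall p n, {subset ch_fil (p + sgv w) n <= ch_fil p n};
  ch_fil_d : forall p n x, x \in ch_fil p n.+1 -> ch_d X n x \in ch_fil p n
}.

Arguments ch_fil {w X} L p n : rename.

Section ChainDg.
Variable X : chain.

(* The extension by zero to negative degrees; ['rV[int]_0] is the zero group. *)
Definition chdg_ob (m : int) : zmodType :=
  match m with Posz n => X n | Negz _ => 'rV[int]_0 end.

Fact posz_pred (n : nat) (m' : int) : n.+1%:Z + sgv Homol = m' -> n%:Z = m'.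
Proof. by move=> <-; rewrite /= -addn1 PoszD addrK. Qed.

Definition chdg_d (m m' : int) : m + sgv Homol = m' -> {additive chdg_ob m -> chdg_ob m'} :=
  match m return m + sgv Homol = m' -> {additive chdg_ob m -> chdg_ob m'} with
  | Posz n.+1 => fun e =>
      ecast k ({additive X n.+1 -> chdg_ob k}) (posz_pred e) (ch_d X n)
  | _ => fun _ => \0
  end.

Lemma chdg_dE n (e : n.+1%:Z + sgv Homol = n%:Z) : chdg_d e = ch_d X n.
Proof. by rewrite /chdg_d eq_axiomK. Qed.

Fact chdg_dd (m m' m'' : int) (e : m + sgv Homol = m') (e' : m' + sgv Homol = m'') x :
  chdg_d e' (chdg_d e x) = 0.
Proof.
case: m e x => [[|n]|n] e x; try by rewrite raddf0.
have em := posz_pred e; move: e e'; case: m' / em => e e'; rewrite chdg_dE.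
case: n e e' x => [|n] e e' x //.
by have em := posz_pred e'; move: e'; case: m'' / em => e'; rewrite chdg_dE ch_dd.
Qed.

Definition dg_of_chain : dgAb Homol := @DgAb Homol chdg_ob chdg_d chdg_dd.

Variables (w : variance) (L : chain_filtration w X).

Definition chdg_fil (p m : int) : zmodClosed (dg_of_chain m) :=
  match m return zmodClosed (dg_of_chain m) with
  | Posz n => L p n
  | Negz _ => full_pred 'rV[int]_0
  end.

Fact chdg_fil_mono p m : {subset chdg_fil (p + sgv w) m <= chdg_fil p m}.
Proof. by case: m => [n|n] //; exact: ch_fil_mono. Qed.

Fact chdg_fil_d p (m m' : int) (e : m + sgv Homol = m') x :
  x \in chdg_fil p m -> dg_d dg_of_chain e x \in chdg_fil p m'.
Proof.
case: m e x => [[|n]|n] e x; try by rewrite rpred0.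
have em := posz_pred e; move: e; case: m' / em => e xL; rewrite [dg_d _ _]chdg_dE.
exact: ch_fil_d.
Qed.

Definition fil_of_chain : filtration w dg_of_chain :=
  @Filtration w Homol dg_of_chain chdg_fil chdg_fil_mono chdg_fil_d.

End ChainDg.

Section Functors.
Context {disp : Order.disp_t} {C : porderType disp}.

Record abFunctor := AbFunctor {
  fob :> C -> zmodType;
  fmap : forall c c', (c <= c')%O -> {additive fob c -> fob c'};
  fmap1 : forall c (h : (c <= c)%O) a, fmap h a = a;
  fmap_comp : forall c c' c'' (h : (c <= c')%O) (h' : (c' <= c'')%O)
                     (h'' : (c <= c'')%O) a, fmap h' (fmap h a) = fmap h'' a
}.
Arguments fmap F {c c'} h : rename.

Record natTrans (F G : abFunctor) := NatTrans {
  nt :> forall c, {additive F c -> G c};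
  nt_nat : forall c c' (h : (c <= c')%O) a, nt c' (fmap F h a) = fmap G h (nt c a)
}.

Section Colim.
Variable F : abFunctor.

Let SF : zmodType := dsum (fun c => F c).

Definition colim_rel : {pred SF} :=
  [pred x | `[< exists c c' (h : (c <= c')%O) (a : F c),
                  x = dsum_in (fmap F h a) - dsum_in a >]].

Lemma colim_relP x :
  reflect (exists c c' (h : (c <= c')%O) (a : F c),
             x = dsum_in (fmap F h a) - dsum_in a) (x \in colim_rel).
Proof. exact: asboolP. Qed.

(* The cokernel presentation; [colim_in_fmap], [colim_ext] and [colim_univ] give
   its universal property. *)
Definition colim : zmodType := subquot (full_pred SF) (span_pred colim_rel).

Definition colim_pi : SF -> colim := cls (full_pred SF) (span_pred colim_rel).
Fact colim_pi_is_additive : zmod_morphism colim_pi.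
Proof. by move=> x y; exact: clsB. Qed.
HB.instance Definition _ :=
  GRing.isZmodMorphism.Build SF colim colim_pi colim_pi_is_additive.

Definition colim_in c (a : F c) : colim := colim_pi (dsum_in a).
Fact colim_in_is_additive c : zmod_morphism (@colim_in c).
Proof. by move=> a b; rewrite /colim_in !raddfB. Qed.
HB.instance Definition _ c :=
  GRing.isZmodMorphism.Build (F c) colim (@colim_in c) (@colim_in_is_additive c).

Lemma colim_in_fmap c c' (h : (c <= c')%O) (a : F c) :
  colim_in (fmap F h a) = colim_in a.
Proof.
apply/eqP; rewrite -subr_eq0 /colim_in -raddfB cls_eq0 //; apply/span_predP => S; apply.
by apply/colim_relP; exists c, c', h, a.
Qed.

Lemma colim_ext (B : zmodType) (f g : {additive colim -> B}) :
  (forall c (a : F c), f (colim_in a) = g (colim_in a)) -> forall x, f x = g x.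
Proof.
move=> fg x; have [y _ ->] := cls_surj x.
exact: (dsum_ext (f := f \o colim_pi) (g := g \o colim_pi)).
Qed.

Lemma colim_univ (B : zmodType) (g : forall c, {additive F c -> B}) :
    (forall c c' (h : (c <= c')%O) a, g c' (fmap F h a) = g c a) ->
  exists f : {additive colim -> B}, forall c (a : F c), f (colim_in a) = g c a.
Proof.
move=> gF; have gB x : x \in span_pred colim_rel -> dsum_lift g x = 0.
  move=> /span_predP /(_ (ker_pred (dsum_lift g))) xg; apply/eqP; apply: xg.
  move=> _ /colim_relP[c [c' [h [a ->]]]].
  by rewrite unfold_in /= raddfB !dsum_lift_in gF subrr.
pose f0 (y : colim) : B := dsum_lift g (val (repr y)).
have f0E x : f0 (colim_pi x) = dsum_lift g x.
  apply/eqP; rewrite -subr_eq0 -raddfB; apply/eqP/gB.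
  rewrite -(@cls_eq0 _ (full_pred SF)) // clsB // clsE subr_eq0.
  by rewrite [X in X == _]reprK.
have f0_add : zmod_morphism f0.
  move=> y z; have [y1 _ ->] := cls_surj y; have [z1 _ ->] := cls_surj z.
  by rewrite -/(colim_pi y1) -/(colim_pi z1) -raddfB !f0E raddfB.
pose fM := GRing.isZmodMorphism.Build colim B f0 f0_add.
pose f : {additive colim -> B} := HB.pack f0 fM.
by exists f => c a; rewrite [LHS]f0E dsum_lift_in.
Qed.

End Colim.

Section ColimMap.
Variables (F G : abFunctor) (t : natTrans F G).

Definition dsum_map : {additive dsum (fun c => F c) -> dsum (fun c => G c)} :=
  dsum_lift (fun c => (@dsum_in _ (fun c => G c) c \o t c
                       : {additive F c -> dsum (fun c => G c)})).

Fact dsum_map_span x :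
  x \in span_pred (@colim_rel F) -> dsum_map x \in span_pred (@colim_rel G).
Proof.
move=> /span_predP /(_ (preim_pred dsum_map (span_pred (@colim_rel G)))); apply.
move=> _ /colim_relP[c [c' [h [a ->]]]]; rewrite unfold_in /= raddfB !dsum_lift_in.
apply/span_predP => S; apply; apply/colim_relP; exists c, c', h, (t c a).
by rewrite /= nt_nat.
Qed.

Definition colim_map : {additive colim F -> colim G} :=
  subquot_map (f := dsum_map) (Z := full_pred _) (Z' := full_pred _)
    (fun _ _ => isT) (fun x _ => @dsum_map_span x).

Lemma colim_mapE c (a : F c) : colim_map (colim_in a) = colim_in (t c a).
Proof.
rewrite [LHS](subquot_mapE (Z := full_pred _) (Z' := full_pred _)) //.
by rewrite [dsum_map _]dsum_lift_in.
Qed.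

End ColimMap.

(* Epimorphisms of [Ab^C] are the objectwise surjective transformations. *)
Definition nt_epi (F G : abFunctor) (t : natTrans F G) : Prop :=
  forall c b, exists a, t c a = b.

Definition projective (P : abFunctor) : Prop :=
  forall (F G : abFunctor) (t : natTrans F G) (g : natTrans P G), nt_epi t ->
  exists h : natTrans P F, forall c a, t c (h c a) = g c a.

Record proj_resolution (F : abFunctor) := ProjResolution {
  res :> nat -> abFunctor;
  res_d : forall n, natTrans (res n.+1) (res n);
  res_aug : natTrans (res 0) F;
  res_proj : forall n, projective (res n);
  res_aug_epi : nt_epi res_aug;
  res_exact0 : forall c (a : res 0 c),
    res_aug c a = 0 <-> exists b, res_d 0 c b = a;
  res_exactS : forall n c (a : res n.+1 c),
    res_d n c a = 0 <-> exists b, res_d n.+1 c b = a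
}.
Arguments res_d {F} P n : rename.

Section LeftDerived.
Variables (F : abFunctor) (P : proj_resolution F).

Fact res_dd n c (a : P n.+2 c) : res_d P n c (res_d P n.+1 c a) = 0.
Proof. by apply/res_exactS; exists a. Qed.

Fact colim_res_dd n x :
  colim_map (res_d P n) (colim_map (res_d P n.+1) x) = 0.
Proof.
apply: (colim_ext (f := colim_map (res_d P n) \o colim_map (res_d P n.+1))
                  (g := \0)) => c a.
by rewrite [LHS]/= !colim_mapE res_dd raddf0.
Qed.

Definition colim_res : chain :=
  @Chain (fun n => colim (P n)) (fun n => colim_map (res_d P n)) colim_res_dd.

End LeftDerived.

(* [A] is the value at [F] of the [n]-th left derived functor of the colimit:
   it is computed by every projective resolution of [F], and there is one.
   For [n < 0] this says that [A] is trivial. *)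
Definition is_left_derived_colim (F : abFunctor) (n : int) (A : zmodType) : Prop :=
  inhabited (proj_resolution F) /\
  forall P : proj_resolution F, isomorphic A (dg_H (dg_of_chain (colim_res P)) n).

Section Nerve.

Definition simplex_pred n (s : {ffun 'I_n.+1 -> C}) : bool :=
  [forall i : 'I_n.+1, forall j : 'I_n.+1, (i <= j)%N ==> (s i <= s j)%O].

(* An [n]-simplex of the nerve is a monotone family [s 0 <= ... <= s n]. *)
Definition simplex n := {s : {ffun 'I_n.+1 -> C} | simplex_pred s}.

Definition vertex n (s : simplex n) (i : 'I_n.+1) : C := val s i.
Definition initial_vertex n (s : simplex n) : C := vertex s ord0.
Definition final_vertex n (s : simplex n) : C := vertex s ord_max.

Lemma vertex_le n (s : simplex n) (i j : 'I_n.+1) :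
  (i <= j)%N -> (vertex s i <= vertex s j)%O.
Proof. by move=> ij; have /forallP/(_ i)/forallP/(_ j)/implyP/(_ ij) := valP s. Qed.

Fact face_pred n (i : 'I_n.+2) (s : simplex n.+1) :
  simplex_pred [ffun j : 'I_n.+1 => vertex s (lift i j)].
Proof.
apply/forallP => j; apply/forallP => k; apply/implyP => jk; rewrite !ffunE.
by apply: vertex_le; rewrite /= leq_bump2.
Qed.

Definition face n (i : 'I_n.+2) (s : simplex n.+1) : simplex n :=
  Sub [ffun j => vertex s (lift i j)] (face_pred i s).

Lemma vertex_face n (i : 'I_n.+2) (s : simplex n.+1) j :
  vertex (face i s) j = vertex s (lift i j).
Proof. by rewrite /vertex SubK ffunE. Qed.

Lemma initial_face n (i : 'I_n.+2) (s : simplex n.+1) :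
  (initial_vertex s <= initial_vertex (face i s))%O.
Proof. by rewrite [X in (_ <= X)%O]vertex_face; exact: vertex_le. Qed.

Lemma final_face n (i : 'I_n.+2) (s : simplex n.+1) :
  (final_vertex (face i s) <= final_vertex s)%O.
Proof. by rewrite [X in (X <= _)%O]vertex_face; apply: vertex_le; exact: leq_ord. Qed.

Lemma simplexP n (s t : simplex n) : vertex s =1 vertex t -> s = t.
Proof. by move=> st; apply: val_inj; apply/ffunP => i; exact: st. Qed.

Variable F : abFunctor.

Definition bar (n : nat) : zmodType :=
  dsum (fun s : simplex n => F (initial_vertex s)).

Definition bar_in n (s : simplex n) : {additive F (initial_vertex s) -> bar n} :=
  (@dsum_in _ (fun s : simplex n => F (initial_vertex s)) s
   : {additive _ -> dsum (fun s : simplex n => F (initial_vertex s))}).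

(* For [i > 0] the map [fmap] below is an identity, by [fmap1]. *)
Definition bar_face n (i : 'I_n.+2) : {additive bar n.+1 -> bar n} :=
  dsum_lift (fun s => (bar_in (face i s) \o fmap F (initial_face i s)
                       : {additive F (initial_vertex s) -> bar n})).

Definition bar_d_fun n (x : bar n.+1) : bar n :=
  \sum_(i < n.+2) bar_face i x *~ (-1) ^+ i.
Fact bar_d_is_additive n : zmod_morphism (@bar_d_fun n).
Proof.
move=> x y; rewrite /bar_d_fun -sumrB.
by apply: eq_bigr => i _; rewrite raddfB mulrzBl.
Qed.
HB.instance Definition _ n :=
  GRing.isZmodMorphism.Build (bar n.+1) (bar n) (@bar_d_fun n)
    (@bar_d_is_additive n).
Definition bar_d n : {additive bar n.+1 -> bar n} := @bar_d_fun n.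

Lemma bar_faceE n (i : 'I_n.+2) (s : simplex n.+1) a :
  bar_face i (bar_in s a) = bar_in (face i s) (fmap F (initial_face i s) a).
Proof. exact: dsum_lift_in. Qed.

Lemma bar_in_eq n (s t : simplex n) c (hs : (c <= initial_vertex s)%O)
    (ht : (c <= initial_vertex t)%O) (a : F c) :
  s = t -> bar_in s (fmap F hs a) = bar_in t (fmap F ht a).
Proof. by move=> st; case: t / st ht => ht; rewrite (bool_irrelevance hs ht). Qed.

Lemma face_face n (i : 'I_n.+2) (j : 'I_n.+3) (s : simplex n.+2)
    (j' : 'I_n.+2) (i' : 'I_n.+3) :
    (i < j)%N -> j' = j.-1 :> nat -> i' = i :> nat ->
  face i (face j s) = face j' (face i' s).
Proof.
move=> ij j'E i'E; apply: simplexP => k; rewrite !vertex_face.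
congr (vertex s _); apply: val_inj; rewrite /= j'E i'E /bump.
case: j ij {j'E} => -[|j] jn //= ij; lia.
Qed.

Lemma bar_face_face n (i : 'I_n.+2) (j : 'I_n.+3) (j' : 'I_n.+2) (i' : 'I_n.+3) x :
    (i < j)%N -> j' = j.-1 :> nat -> i' = i :> nat ->
  bar_face i (bar_face j x) = bar_face j' (bar_face i' x).
Proof.
move=> ij j'E i'E.
apply: (dsum_ext (f := bar_face i \o bar_face j)
                 (g := bar_face j' \o bar_face i')) => s a.
rewrite [LHS]/= [RHS]/= -/(bar_in s a) !bar_faceE.
have le2 k l : (initial_vertex s <= initial_vertex (face (n := n) k (face l s)))%O.
  by apply: le_trans (initial_face _ _); exact: initial_face.
rewrite (fmap_comp _ _ (le2 _ _)) (fmap_comp _ _ (le2 _ _)).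
by apply: bar_in_eq; exact: face_face.
Qed.

Fact bar_dd n x : bar_d n (bar_d n.+1 x) = 0.
Proof.
pose T (p : 'I_n.+2 * 'I_n.+3) :=
  bar_face p.1 (bar_face p.2 x) *~ ((-1) ^+ (p.1 + p.2)).
have -> : bar_d n (bar_d n.+1 x) = \sum_p T p.
  rewrite -(pair_bigA _ (fun i j => T (i, j))); apply: eq_bigr => i _.
  rewrite raddf_sum mulrz_suml; apply: eq_bigr => j _.
  by rewrite raddfMz -mulrzA -exprD addnC.
pose h (p : 'I_n.+2 * 'I_n.+3) : 'I_n.+2 * 'I_n.+3 := (inord p.2.-1, inord p.1).
pose h' (p : 'I_n.+2 * 'I_n.+3) : 'I_n.+2 * 'I_n.+3 := (inord p.2, inord p.1.+1).
have pE (p q : 'I_n.+2 * 'I_n.+3) : p.1 = q.1 :> nat -> p.2 = q.2 :> nat -> p = q.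
  by case: p q => [i j] [k l] /= ik jl; congr pair; exact: val_inj.
have h1 (p : 'I_n.+2 * 'I_n.+3) : (h p).1 = p.2.-1 :> nat.
  by rewrite inordK //; have := ltn_ord p.2; lia.
have h2 (p : 'I_n.+2 * 'I_n.+3) : (h p).2 = p.1 :> nat.
  by rewrite inordK //; have := ltn_ord p.1; lia.
have h'2 (p : 'I_n.+2 * 'I_n.+3) : (h' p).2 = p.1.+1 :> nat.
  by rewrite inordK //; have := ltn_ord p.1; lia.
have h'1 (p : 'I_n.+2 * 'I_n.+3) : (p.2 <= p.1)%N -> (h' p).1 = p.2 :> nat.
  by move=> pp; rewrite inordK //; have := ltn_ord p.1; lia.
rewrite (bigID (fun p : 'I_n.+2 * 'I_n.+3 => p.1 < p.2)%N) /=.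
rewrite [X in _ + X](reindex_onto h h') /=; last first.
  by move=> p; rewrite -leqNgt => pp; apply: pE; rewrite ?h1 ?h2 ?h'1 ?h'2.
rewrite [X in _ + X](eq_bigl (fun p : 'I_n.+2 * 'I_n.+3 => p.1 < p.2)%N); last first.
  move=> p; rewrite h1 h2 -leqNgt; apply/andP/idP => [[pp /eqP e]|pp].
    by rewrite -e h'2 h'1 ?h1 ?h2.
  have pp' : (p.1 <= p.2.-1)%N by lia.
  by split=> //; apply/eqP/pE; rewrite ?h'1 ?h'2 ?h1 ?h2 //; lia.
rewrite -big_split big1 //= => p pp; rewrite /T h1 h2.
rewrite (bar_face_face x pp (h1 p) (h2 p)) -mulrzDr.
suff -> : (-1) ^+ (p.1 + p.2) + (-1) ^+ (p.2.-1 + p.1) = 0 :> int by rewrite mulr0z.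
have -> : (p.1 + p.2 = (p.2.-1 + p.1).+1)%N by lia.
by rewrite exprS mulN1r addNr.
Qed.

Definition bar_chain : chain := @Chain bar bar_d bar_dd.

Lemma bar_d_supported n (P : forall n, {pred simplex n}) :
    (forall s : simplex n.+1, P n.+1 s -> forall i, P n (face i s)) ->
  forall x, x \in supported (P n.+1) -> bar_d n x \in supported (P n).
Proof.
move=> PF; apply: (@supported_ind _ _ _ (preim_pred (bar_d n) (supported (P n)))).
move=> s a Ps; rewrite unfold_in; apply: rpred_sum => i _; apply: rpredMz.
by rewrite -/(bar_in s a) bar_faceE; apply: supported_in; exact: PF.
Qed.

End Nerve.

(* [precedes p p'] only makes sense for [p < p'], hence the first conjunct. *)
Definition precedes (p p' : C) : Prop :=
  (p < p')%O /\
  forall p'', (p <= p'')%O -> (p'' <= p')%O -> p'' = p \/ p'' = p'.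

Record decreasing_degree (deg : C -> int) : Prop := DecreasingDegree {
  deg_lt : forall p p', (p < p')%O -> deg p' < deg p;
  deg_precedes : forall p p', precedes p p' -> deg p' = deg p - 1
}.

Section DegreeFiltrations.
Variables (deg : C -> int) (deg_dec : decreasing_degree deg) (F : abFunctor).

Lemma deg_le p p' : (p <= p')%O -> deg p' <= deg p.
Proof.
by rewrite le_eqVlt => /predU1P[-> //|/(deg_lt deg_dec)/ltW].
Qed.

Definition final_ge (p : int) n : {pred simplex n} :=
  [pred s | p <= deg (final_vertex s)].
Definition initial_le (p : int) n : {pred simplex n} :=
  [pred s | deg (initial_vertex s) <= p].

Definition final_fil (p : int) n : zmodClosed (bar_chain F n) :=
  supported (A := fun s : simplex n => F (initial_vertex s)) (@final_ge p n).
Definition initial_fil (p : int) n : zmodClosed (bar_chain F n) :=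
  supported (A := fun s : simplex n => F (initial_vertex s)) (@initial_le p n).

Fact final_fil_mono p n : {subset final_fil (p + sgv Cohom) n <= final_fil p n}.
Proof.
move=> x /supportedP xP; apply/supportedP => s /xP; rewrite /final_ge /=; lia.
Qed.

Fact final_fil_d p n x :
  x \in final_fil p n.+1 -> ch_d (bar_chain F) n x \in final_fil p n.
Proof.
apply: (bar_d_supported (P := final_ge p)) => s; rewrite /final_ge /= => ps i.
exact: le_trans ps (deg_le (final_face i s)).
Qed.

Fact initial_fil_mono p n :
  {subset initial_fil (p + sgv Homol) n <= initial_fil p n}.
Proof.
move=> x /supportedP xP; apply/supportedP => s /xP; rewrite /initial_le /=; lia.
Qed.

Fact initial_fil_d p n x :
  x \in initial_fil p n.+1 -> ch_d (bar_chain F) n x \in initial_fil p n.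
Proof.
apply: (bar_d_supported (P := initial_le p)) => s; rewrite /initial_le /= => ps i.
exact: le_trans (deg_le (initial_face i s)) ps.
Qed.

(* [C_*(C, F)] with [C_n] in degree [n]; the cohomological grading [C^(-n) = C_n]
   is [regrade bar_dg]. *)
Definition bar_dg : dgAb Homol := dg_of_chain (bar_chain F).

Definition final_filtration : filtration Cohom bar_dg :=
  fil_of_chain (@ChainFiltration Cohom (bar_chain F) final_fil
                  final_fil_mono final_fil_d).

Definition initial_filtration : filtration Homol bar_dg :=
  fil_of_chain (@ChainFiltration Homol (bar_chain F) initial_fil
                  initial_fil_mono initial_fil_d).

End DegreeFiltrations.
End Functors.

Arguments abFunctor {disp} C.

(* Main.v *)
(* Any filtered complex has a spectral sequence with the standard pages
   Z_r / B_r, which gives both spectral sequences, and its first page is the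
   homology of the graded pieces.  What is left is that the bar complex
   C_*(C, F) computes the left derived functors of the colimit.  For a
   projective resolution P of F, the groups C_p(C, P_q), augmented to C_p(C, F)
   and to colim P_q, form a double complex whose rows and columns are exact:
   the columns because C_p(C, -) is a direct sum of evaluations, the rows
   because P_q is a summand of a sum of representable functors, on whose bar
   complex coning off a simplex from the representing object is a contraction.
   Hence C_*(C, F) and colim P_* have the same homology. *)
Require Import Defs.
From HB Require Import structures.
From mathcomp Require Import all_boot all_order all_algebra.
From mathcomp Require Import zify ring boolp.

Set Implicit Arguments.
Unset Strict Implicit.
Unset Printing Implicit Defensive.

Import Order.TTheory GRing.Theory Num.Theory.

Local Open Scope ring_scope.

(** * Isomorphisms of abelian groups and of subquotients *)

Lemma inj_surj_bij (T U : Type) (f : T -> U) :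
  injective f -> (forall y, exists x, f x = y) -> bijective f.
Proof.
by move=> fI /choice[g fg]; exists g => // x; apply: fI; rewrite fg.
Qed.

Lemma additive_bij_inv (A B : zmodType) (f : {additive A -> B}) :
  bijective f -> exists g : {additive B -> A}, cancel f g /\ cancel g f.
Proof.
case=> g fK gK.
have g_add : zmod_morphism g.
  by move=> x y; apply: (can_inj fK); rewrite raddfB !gK.
pose gM := GRing.isZmodMorphism.Build B A g g_add.
by exists (HB.pack_for {additive B -> A} g gM).
Qed.

Lemma isomorphic_sym (A B : zmodType) : isomorphic A B -> isomorphic B A.
Proof. by case=> f /additive_bij_inv[g [fK gK]]; exists g; exists f. Qed.

Lemma isomorphic_trans (A B C : zmodType) :
  isomorphic A B -> isomorphic B C -> isomorphic A C.
Proof.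
by case=> f fB [g gB]; exists (g \o f : {additive A -> C}); exact: bij_comp.
Qed.

Lemma isomorphic_refl (A : zmodType) : isomorphic A A.
Proof. by exists (idfun : {additive A -> A}); exists idfun. Qed.

Section SubquotientIso.
Variables (A : zmodType) (Z B : zmodClosed A).

(** Additivity is asked on [Z] only: the maps fed in are built from [cls], which sends everything
    outside its subgroup to 0 and is additive only inside. *)
Lemma subquot_lift (H : zmodType) (f : A -> H) :
    {in Z &, {morph f : x y / x - y}} -> (forall x, x \in Z -> x \in B -> f x = 0) ->
  exists g : {additive subquot Z B -> H}, forall x, x \in Z -> g (cls Z B x) = f x.
Proof.
move=> fB f0; pose g (y : subquot Z B) := f (val (repr y)).
have gE x : x \in Z -> g (cls Z B x) = f x.
  move=> xZ; set y := cls Z B x; have yZ : val (repr y) \in Z by exact: valP.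
  have yE : cls Z B (val (repr y)) = y by rewrite clsE [LHS]reprK.
  apply/eqP; rewrite -subr_eq0 -fB //; apply/eqP/f0; first exact: rpredB.
  by rewrite -(@cls_eq0 _ Z) ?rpredB // clsB // yE subrr.
have g_add : zmod_morphism g.
  move=> y1 y2; have [x1 x1Z ->] := cls_surj y1; have [x2 x2Z ->] := cls_surj y2.
  by rewrite -clsB // !gE ?rpredB // fB.
pose gM := GRing.isZmodMorphism.Build (subquot Z B) H g g_add.
by exists (HB.pack_for {additive subquot Z B -> H} g gM).
Qed.

Lemma subquot_lift_bij (H : zmodType) (f : A -> H) :
    {in Z &, {morph f : x y / x - y}} ->
    (forall x, x \in Z -> f x = 0 <-> x \in B) ->
    (forall h, exists2 x, x \in Z & f x = h) ->
  exists g : {additive subquot Z B -> H},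
    bijective g /\ forall x, x \in Z -> g (cls Z B x) = f x.
Proof.
move=> fB f0 fS; have [x xZ /f0 //|g gE] := subquot_lift fB; first exact.
exists g; split=> //; apply: inj_surj_bij => [|h]; last first.
  by have [x xZ <-] := fS h; exists (cls Z B x); exact: gE.
apply: raddf_inj => y; have [x xZ ->] := cls_surj y; rewrite gE // => /f0 xB.
by apply/eqP; rewrite cls_eq0 ?xB.
Qed.

(* An isomorphism given by an additive relation, so that zigzags of lifts can be
   followed without choosing them. *)
Lemma subquot_rel_iso (A' : zmodType) (Z' B' : zmodClosed A') (R : A -> A' -> Prop) :
    (forall x x' y y', R x x' -> R y y' -> R (x - y) (x' - y')) ->
    (forall x, x \in Z -> exists2 x', x' \in Z' & R x x') ->
    (forall x', x' \in Z' -> exists2 x, x \in Z & R x x') ->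
    (forall x x', x \in Z -> x' \in Z' -> R x x' -> x \in B <-> x' \in B') ->
  isomorphic (subquot Z B) (subquot Z' B').
Proof.
move=> RB RZ RZ' RBB'.
have /choice[f fP] (x : A) : exists x', x \in Z -> x' \in Z' /\ R x x'.
  have [xZ|_] := boolP (x \in Z); last by exists 0.
  by have [x' ? ?] := RZ _ xZ; exists x'.
(* The chosen [f] need not be additive, but two partners of [x] differ by a partner of [x - x = 0],
   which lies in [B]; so the class of [f x] does not depend on the choice. *)
have cls_f x x' : x \in Z -> x' \in Z' -> R x x' ->
    cls Z' B' (f x) = cls Z' B' x'.
  move=> xZ xZ' Rx; have [fxZ Rfx] := fP _ xZ; apply/eqP.
  have dZ : x - x \in Z by exact: rpredB.
  have dZ' : f x - x' \in Z' by exact: rpredB.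
  rewrite -subr_eq0 -clsB // cls_eq0 //; apply/(RBB' _ _ dZ dZ'); first exact: RB.
  by rewrite subrr rpred0.
have [||h'|g [gB _]] := @subquot_lift_bij _ (fun x => cls Z' B' (f x)).
- move=> x y xZ yZ; have [? ?] := fP _ xZ; have [? ?] := fP _ yZ.
  rewrite -clsB //; apply: cls_f; rewrite ?rpredB //; exact: RB.
- move=> x xZ; have [fxZ Rx] := fP _ xZ.
  rewrite (RBB' _ _ xZ fxZ Rx) -(@cls_eq0 _ Z') //; split=> [-> //|/eqP//].
- have [x' xZ' ->] := cls_surj h'; have [x xZ Rx] := RZ' _ xZ'.
  by exists x => //; exact: cls_f.
by exists g.
Qed.

End SubquotientIso.

(** * The standard spectral sequence of a filtered complex and its first page *)

Section StandardSpectralSequence.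
Variables (v : variance) (K : dgAb v) (L : filtration v K).

Local Notation cyc r p m := (@cyc_pred v K L r p m).
Local Notation bnd r p m := (@bnd_pred v K L r p m).

Lemma fil_eq p p' m (x : K m) : p = p' -> x \in L p m -> x \in L p' m.
Proof. by move=> ->. Qed.

(** The pages live in degrees such as [b.1 + b.2], equal but not convertible to [m + sgv v]; here
    and in [bndP] the degree equality is therefore left free. *)
Lemma cycP (r p m m' : int) (e : m + sgv v = m') x :
  reflect (x \in L p m /\ dg_d K e x \in L (p + sgv v * r) m')
          (x \in cyc r p m).
Proof. by case: m' / e; exact: cyc_predP. Qed.

Lemma bndP (r p m m' : int) (e : m + sgv v = m') x :
  reflect (exists y z,
     [/\ y \in cyc (r - 1) (p + sgv v) m',
         z \in cyc (r - 1) (p - sgv v * (r - 1)) m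
       & x = y + dg_d K e z]) (x \in bnd r p m').
Proof.
have mE : m' - sgv v = m by rewrite -e addrK.
by case: m / mE e => e; rewrite (eq_irrelevance e (subrK _ _)); exact: bnd_predP.
Qed.

Lemma cyc_d (r p m p' m' : int) (e : m + sgv v = m') x : p + sgv v * r = p' ->
  x \in cyc r p m -> dg_d K e x \in cyc r p' m'.
Proof.
move=> <- /(cycP _ _ e)[_ dxL]; apply/cyc_predP.
by rewrite dg_dd rpred0.
Qed.

(** [d (y + d z) = d y], and [y] serves as second witness of the new boundary, since its index
    [p + sgv v] equals [p' - sgv v * (r - 1)]. *)
Lemma bnd_d (r p m p' m' : int) (e : m + sgv v = m') x : p + sgv v * r = p' ->
  x \in bnd r p m -> dg_d K e x \in bnd r p' m'.
Proof.
move=> <- /bnd_predP[y [z [yc zc ->]]]; apply/(bndP _ _ e); exists 0, y.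
rewrite rpred0 raddfD dg_dd addr0 add0r; split=> //.
by rewrite (_ : p + _ - _ = p + sgv v) //; ring.
Qed.

Lemma cyc_mono r p m : {subset cyc (r + 1) p m <= cyc r p m}.
Proof.
move=> x /cyc_predP[xL]; rewrite mulrDr mulr1 addrA => dxL.
by apply/cyc_predP; split=> //; apply: fil_mono.
Qed.

Section Page.
Variable r : nat.

Fact page_deg (a b : int * int) :
  a + bideg v r = b -> a.1 + a.2 + sgv v = b.1 + b.2.
Proof. by move=> <-; rewrite /bideg /=; ring. Qed.

Fact page_fil (a b : int * int) : a + bideg v r = b -> a.1 + sgv v * r%:Z = b.1.
Proof. by move=> <-. Qed.

Definition page_d (a b : int * int) (e : a + bideg v r = b) :
    {additive std_page L r a -> std_page L r b} :=
  subquot_map (fun x => @cyc_d r%:Z _ _ _ _ (page_deg e) x (page_fil e))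
              (fun x _ => @bnd_d r%:Z _ _ _ _ (page_deg e) x (page_fil e)).

Lemma page_dE (a b : int * int) (e : a + bideg v r = b)
    (e' : a.1 + a.2 + sgv v = b.1 + b.2) x :
  x \in cyc r%:Z a.1 (a.1 + a.2) ->
  page_d e (std_cls L r x) = std_cls L r (dg_d K e' x).
Proof.
by move=> xZ; rewrite (eq_irrelevance e' (page_deg e)); exact: subquot_mapE.
Qed.

Lemma page_dd (a b c : int * int) (e : a + bideg v r = b)
  (e' : b + bideg v r = c) x : page_d e' (page_d e x) = 0.
Proof.
have [y yZ ->] := cls_surj x.
rewrite (page_dE _ (page_deg e)) // (page_dE _ (page_deg e')); last first.
  exact: cyc_d (page_fil e) yZ.
by rewrite dg_dd; apply/eqP; rewrite cls_eq0 rpred0.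
Qed.

Let pageH a := homology (page_d (subrK (bideg v r) a))
                        (page_d (erefl (a + bideg v r))).

(** The map built first goes from [Z_(r+1) / B_(r+1)] to the homology of the page, because in that
    direction representatives are simply included; the required map is its inverse. *)
Lemma page_next a : exists g : {additive pageH a -> std_page L r.+1 a},
  bijective g /\ forall x, x \in cyc r.+1%:Z a.1 (a.1 + a.2) ->
    g (cls _ _ (std_cls L r x)) = std_cls L r.+1 x.
Proof.
set p := a.1; set m := p + a.2.
have rS : r.+1%:Z = r%:Z + 1 by rewrite -addn1 PoszD.
have rP : r.+1%:Z - 1 = r%:Z by rewrite rS addrK.
set a0 := a - bideg v r; set a1 := a + bideg v r.
have e0 := page_deg (subrK (bideg v r) a); have e1 := page_deg (erefl a1).
have a0E : p - sgv v * r%:Z = a0.1 by [].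
have sub_cyc x : x \in cyc r.+1%:Z p m -> x \in cyc r%:Z p m.
  by rewrite rS; exact: cyc_mono.
have cyc_ker x : x \in cyc r.+1%:Z p m ->
    std_cls L r x \in ker_pred (page_d (erefl a1)).
  move=> xZ; rewrite inE (page_dE _ e1) ?sub_cyc // cls_eq0; last first.
    by apply: cyc_d (page_fil (erefl a1)) _; rewrite ?sub_cyc.
  (* [d x] lies one filtration step deeper than [Z_r] demands, so it is by itself a first summand of
     an element of [B_r]. *)
  apply/(bndP _ _ e1); exists (dg_d K e1 x), 0; rewrite rpred0 raddf0 addr0.
  split=> //; apply/cyc_predP; rewrite dg_dd rpred0; split=> //.
  have /(cycP _ _ e1)[_] := xZ.
  by apply: fil_eq; rewrite rS /a1 /p /=; ring.
have cyc_bnd w : w \in cyc r%:Z a0.1 (a0.1 + a0.2) -> dg_d K e0 w \in cyc r%:Z p m.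
  by apply: cyc_d; rewrite /a0 /p /=; ring.
have std_eq x y : x \in cyc r%:Z p m -> y \in cyc r%:Z p m ->
    (std_cls L r x == std_cls L r y :> std_page L r a) = (x - y \in bnd r%:Z p m).
  move=> xZ yZ; rewrite -subr_eq0 /std_cls -clsB //; apply: cls_eq0.
  exact: rpredB.
have [|x xZ|h|f [fB fE]] := @subquot_lift_bij _ (cyc r.+1%:Z p m)
    (bnd r.+1%:Z p m) (pageH a) (fun x => cls _ _ (std_cls L r x)).
- move=> x y /[dup] xZ /sub_cyc xZr /[dup] yZ /sub_cyc yZr.
  rewrite [X in cls _ _ X](_ : _ = std_cls L r x - std_cls L r y).
    by apply: clsB; exact: cyc_ker.
  exact: clsB.
- rewrite (rwP eqP) cls_eq0; last exact: cyc_ker.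
  have xZr := sub_cyc _ xZ; split.
    case/im_predP=> w'; have [w wZ ->] := cls_surj w'; rewrite (page_dE _ e0) //.
    have dwZ := cyc_bnd _ wZ.
    move/esym/eqP; rewrite std_eq // => /(bndP _ _ e0).
    (* Here [x - d w = y + d z], so [w + z] is the second witness for [B_(r+1)]; [y] qualifies as
       the first because [d y = d x], and [x] is in [Z_(r+1)]. *)
    case=> y [z [/cyc_predP[yL _] /(cycP _ _ e0)[zL dzL] xE]].
    have {}xE : x = y + dg_d K e0 (w + z).
      by rewrite raddfD /= addrCA -xE addrC subrK.
    apply/(bndP _ _ e0); exists y, (w + z); rewrite rP; split=> //.
      apply/cyc_predP; split=> //.
      have /cyc_predP[_] := xZ; rewrite xE raddfD /= dg_dd addr0.
      by apply: fil_eq; rewrite rS; ring.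
    have /(cycP _ _ e0)[wL dwL] := wZ.
    have zL' : z \in L (p - sgv v * r%:Z) _.
      by apply: fil_mono; apply: fil_eq zL; ring.
    apply/(cycP _ _ e0); split; first exact: rpredD.
    by rewrite raddfD rpredD //; apply: fil_eq dzL; ring.
  case/(bndP _ _ e0)=> y [w]; rewrite rP => -[yZ wZ xE].
  have dwZ := cyc_bnd _ wZ.
  apply/im_predP; exists (std_cls L r w); rewrite (page_dE _ e0) //.
  apply/eqP; rewrite std_eq //.
  apply/(bndP _ _ e0); exists (- y), 0; rewrite rpred0 raddf0 addr0 rpredN.
  split=> //; first by apply: cyc_mono; rewrite subrK.
  by rewrite xE opprD addrCA subrr addr0.
- have [u uZ ->] := cls_surj h; have [x xZ uE] := cls_surj u.
  rewrite uE -/(std_cls L r x) in uZ *; move: uZ => {u uE}.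
  rewrite inE (page_dE _ e1) // cls_eq0; last exact: cyc_d (page_fil (erefl a1)) _.
  (* Replacing [x] by [x - z] leaves [d (x - z) = y], deep enough for [Z_(r+1)]. The class does not
     change, since [z] has filtration [p + sgv v] and lies in [B_r]. *)
  case/(bndP _ _ e1)=> y [z [yZ zZ dxE]].
  have /(cycP _ _ e1)[xL dxL] := xZ; have /(cycP _ _ e1)[zL dzL] := zZ.
  have zL' : z \in L (p + sgv v) m by apply: fil_eq zL; rewrite /a1 /p /=; ring.
  have xzZ : x - z \in cyc r.+1%:Z p m.
    apply/(cycP _ _ e1); rewrite raddfB dxE addrK rpredB //; last exact: fil_mono.
    have /cyc_predP[yL _] := yZ; split=> //; apply: fil_eq yL.
    by rewrite rS /a1 /p /=; ring.
  exists (x - z); first exact: xzZ.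
  congr (cls _ _ _); apply/eqP; rewrite (std_eq _ _ (sub_cyc _ xzZ) xZ).
  rewrite (_ : x - z - x = - z); last by rewrite addrAC subrr add0r.
  apply/(bndP _ _ e0); exists (- z), 0; rewrite rpred0 raddf0 addr0 rpredN.
  split=> //; apply/(cycP _ _ e1); split=> //.
  by apply: fil_eq dzL; rewrite /a1 /p /=; ring.
have [g [fK gK]] := additive_bij_inv fB.
exists g; split=> [|x xZ]; first by exists f.
by rewrite -fE // fK.
Qed.

End Page.
End StandardSpectralSequence.

Lemma ss_associated_exists v (K : dgAb v) (L : filtration v K) :
  exists E, ss_associated L E.
Proof.
pose next r a := cid (page_next L r a).
exists (@SpectralSequence v (std_page L) (page_d L) (@page_dd _ _ L)
  (fun r a => projT1 (next r a)) (fun r a => (projT2 (next r a)).1)).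
exists (fun r a => idfun); split=> [r a|r a b e e' x xZ|r a x xZ].
- by exists id.
- exact: page_dE.
- exact: (projT2 (next r a)).2.
Qed.

(** [Z_1] consists of the lifts to [L p] of cycles of the graded piece. For [Z_0] the condition on
    [d x] is automatic, so [B_1] is [L (p + sgv v) + d (L p)], up to intersection with nothing more
    than the lifts of boundaries. *)
Lemma homology_gr v (K : dgAb v) (L : filtration v K) (a : int * int) :
  isomorphic (dg_H (gr L a.1) (a.1 + a.2)) (std_page L 1 a).
Proof.
set p := a.1; set m := p + a.2.
pose e0 := subrK (sgv v) m; pose e1 := erefl (m + sgv v).
apply: (@subquot_rel_iso _ _ _ _ _ _ (fun y x => x \in L p m /\ y = cls _ _ x)).
- by move=> y1 y2 x1 x2 [x1L ->] [x2L ->]; rewrite clsB // rpredB.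
- move=> y; have [x xL ->] := cls_surj y; rewrite inE [dg_d _ _]/= gr_dE //.
  rewrite cls_eq0; last exact: fil_d.
  move=> dxL; exists x => //.
  by apply/cyc_predP; rewrite mulr1.
- move=> x /cyc_predP[xL]; rewrite mulr1 => dxL.
  exists (cls (L p m) (L (p + sgv v) m) x) => //.
  by rewrite inE [dg_d _ _]/= gr_dE // cls_eq0 //; exact: fil_d.
move=> y x _ _ [xL ->]; split.
  case/im_predP=> y'; have [w wL ->] := cls_surj y'; rewrite [dg_d _ _]/= gr_dE //.
  move/esym/eqP; rewrite -subr_eq0 -clsB //; last exact: fil_d.
  rewrite cls_eq0; last by apply: rpredB => //; exact: fil_d.
  move=> xwL.
  apply/bnd_predP; exists (x - dg_d K e0 w), w; rewrite subrr mulr0 subr0 subrK.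
  by split=> //; apply/cyc_predP; rewrite mulr0 addr0; split=> //; exact: fil_d.
case/bnd_predP=> y' [w []]; rewrite subrr mulr0 subr0.
move=> /cyc_predP[yL _] /cyc_predP[wL _] xE.
apply/im_predP; exists (cls _ _ w); rewrite [dg_d _ _]/= gr_dE //.
apply/eqP; rewrite eq_sym -subr_eq0 -clsB //; last exact: fil_d.
rewrite cls_eq0; last by apply: rpredB => //; exact: fil_d.
by rewrite xE addrK.
Qed.

(** Degrees such as [- - n] and [n] are equal without being convertible; with every degree proof
    left free, homology can be moved between them. *)
Lemma homology_degree v (K : dgAb v) (m0 m m1 n0 n n1 : int)
    (e0 : m0 + sgv v = m) (e1 : m + sgv v = m1)
    (f0 : n0 + sgv v = n) (f1 : n + sgv v = n1) : m = n ->
  isomorphic (homology (dg_d K e0) (dg_d K e1)) (homology (dg_d K f0) (dg_d K f1)).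
Proof.
move=> mn; case: n / mn f0 f1 => f0 f1.
have mn0 : m0 = n0 by apply: (addIr (sgv v)); rewrite e0 f0.
case: n0 / mn0 f0 => f0; case: m1 / e1; case: n1 / f1.
by rewrite (eq_irrelevance e0 f0); exact: isomorphic_refl.
Qed.

Lemma homology_regrade v (K : dgAb v) (n m : int) : m = - n ->
  isomorphic (dg_H (regrade K) m) (dg_H K n).
Proof. by 
move=> ->; exact: (@homology_degree v K _ _ _ _ _ _
  (regrade_eq (subrK (sgv (opv v)) (- n))) (regrade_eq (erefl _)) _ _ (opprK n)). Qed.

Lemma page1_gr v (K : dgAb v) (L : filtration (opv v) K)
    (E : spectral_sequence (opv v)) :
  ss_associated (regrade_fil L) E ->
  forall p q n : int, p + q = - n -> isomorphic (dg_H (gr L p) n) (E 1%N (p, q)).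
Proof.
case=> phi [phiB _ _] p q n pqn.
apply: (@isomorphic_trans _ (std_page (regrade_fil L) 1 (p, q))); last first.
  by exists (phi 1%N (p, q)).
apply: isomorphic_trans (homology_gr _ _) => /=.
(* Taking the graded piece and changing the grading commute up to conversion. *)
exact/isomorphic_sym/(homology_regrade (gr L p)).
Qed.

(** * Double complexes with exact interior: row 0 against column 0 *)

(* First quadrant, with commuting differentials. Only the nodes off the edges
   [p = 0] and [q = 0] are exact; the edges carry two complexes, shifted by one. *)
Record resolving_dc := ResolvingDc {
  dc_ob :> nat -> nat -> zmodType;
  dc_h : forall p q, {additive dc_ob p.+1 q -> dc_ob p q};
  dc_v : forall p q, {additive dc_ob p q.+1 -> dc_ob p q};
  dc_hh : forall p q x, dc_h p q (dc_h p.+1 q x) = 0;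
  dc_vv : forall p q x, dc_v p q (dc_v p q.+1 x) = 0;
  dc_hv : forall p q x, dc_h p q (dc_v p.+1 q x) = dc_v p q (dc_h p q.+1 x);
  dc_h_exact : forall p q x, dc_h p q.+1 x = 0 -> exists y, dc_h p.+1 q.+1 y = x;
  dc_v_exact : forall p q x, dc_v p.+1 q x = 0 -> exists y, dc_v p.+1 q.+1 y = x;
  dc_h_surj : forall q x, exists y, dc_h 0 q.+1 y = x;
  dc_v_surj : forall p x, exists y, dc_v p.+1 0 y = x
}.

Definition dc_transpose (D : resolving_dc) : resolving_dc :=
  @ResolvingDc (fun p q => D q p) (fun p q => dc_v D q p) (fun p q => dc_h D q p)
    (fun p q => @dc_vv D q p) (fun p q => @dc_hh D q p)
    (fun p q x => esym (@dc_hv D q p x))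
    (fun p q => @dc_v_exact D q p) (fun p q => @dc_h_exact D q p)
    (@dc_v_surj D) (@dc_h_surj D).

Definition dc_sum (D : resolving_dc) (p q : nat) :
    {additive (D p.+2 q.+1 * D p.+1 q.+2)%type -> D p.+1 q.+1} :=
  (dc_h D p.+1 q.+1 \o fst) \+ (dc_v D p.+1 q.+1 \o snd).

(* These groups agree along each antidiagonal, and they interpolate between the
   homology of row [0] and that of column [0]. *)
Definition dc_H (D : resolving_dc) (p q : nat) : zmodType :=
  homology (dc_sum D p q)
    (dc_v D p q \o dc_h D p q.+1 : {additive D p.+1 q.+1 -> D p q}).

Lemma dc_H_transpose D p q : isomorphic (dc_H D p q) (dc_H (dc_transpose D) q p).
Proof.
apply: (@subquot_rel_iso _ _ _ _ _ _ eq) => [x y x' y' -> -> //|x xZ|x xZ|x _ xZ _ <-].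
- by exists x => //; rewrite inE /= dc_hv; exact: xZ.
- by exists x => //; rewrite inE /= -dc_hv; exact: xZ.
split=> /im_predP[[a b] <-]; apply/im_predP; exists (b, a); exact: addrC.
Qed.

(** Neighbours [u] and [u'] on an antidiagonal are related when they have the same image at node
    [(p+1, q+1)]. Being a cycle says that this image is killed by the other differential there, so
    exactness supplies a partner. *)
Lemma dc_H_step D p q : isomorphic (dc_H D p.+1 q) (dc_H D p q.+1).
Proof.
apply: (@subquot_rel_iso _ _ _ _ _ _
  (fun u u' => dc_h D p.+1 q.+1 u = dc_v D p.+1 q.+1 u')).
- by move=> x x' y y' xE yE; rewrite !raddfB xE yE.
- move=> u; rewrite inE => /eqP /dc_v_exact[u' u'E]; exists u' => //.
  by rewrite inE /= -dc_hv u'E dc_hh.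
- move=> u'; rewrite inE /= -dc_hv => /eqP /dc_h_exact[u uE]; exists u => //.
  by rewrite inE /= uE dc_vv.
move=> u u' _ _ uu'; split=> /im_predP[[a b]] /=.
  (* From [u = h a + v b] follows [v u' = h u = h (v b) = v (h b)], so exactness writes [u' - h b]
     as some [v c]. *)
  move=> uE; have : dc_v D p.+1 q.+1 (u' - dc_h D p.+1 q.+2 b) = 0.
    by rewrite raddfB -uu' -uE raddfD /= dc_hh add0r dc_hv subrr.
  by case/dc_v_exact=> c cE; apply/im_predP; exists (b, c); rewrite /= cE addrC subrK.
move=> uE; have : dc_h D p.+1 q.+1 (u - dc_v D p.+2 q.+1 a) = 0.
  by rewrite raddfB uu' -uE raddfD /= dc_vv addr0 dc_hv subrr.
by case/dc_h_exact=> c cE; apply/im_predP; exists (c, a); rewrite /= cE subrK.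
Qed.

(** The vertical map onto row 0 is surjective, and its kernel is the image of the next vertical map,
    which [dc_sum] already divides out. *)
Lemma dc_H_row D n :
  isomorphic (dc_H D n 0) (homology (dc_h D n.+1 0) (dc_h D n 0)).
Proof.
apply: (@subquot_rel_iso _ _ _ _ _ _ (fun u x => dc_v D n.+1 0 u = x)).
- by move=> x x' y y' <- <-; rewrite raddfB.
- move=> u; rewrite inE => /eqP uZ; exists (dc_v D n.+1 0 u) => //.
  by rewrite inE dc_hv; apply/eqP.
- move=> x; rewrite inE => /eqP xZ; have [u uE] := dc_v_surj x.
  by exists u => //; rewrite inE /= -dc_hv uE xZ.
move=> u _ _ _ <-; split=> /im_predP.
  case=> -[a b] <-; apply/im_predP; exists (dc_v D n.+2 0 a).
  by rewrite /= raddfD /= dc_vv addr0 dc_hv.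
case=> x; have [a <-] := dc_v_surj x => aE.
have : dc_v D n.+1 0 (u - dc_h D n.+1 1 a) = 0 by rewrite raddfB -aE dc_hv subrr.
by case/dc_v_exact=> b bE; apply/im_predP; exists (a, b); rewrite /= bE addrC subrK.
Qed.

Lemma dc_H_antidiag D p q : isomorphic (dc_H D (p + q) 0) (dc_H D p q).
Proof.
elim: q p => [|q IH] p; first by rewrite addn0; exact: isomorphic_refl.
by rewrite addnS -addSn; apply: isomorphic_trans (IH _) (dc_H_step _ _ _).
Qed.

(** Row 0 is read off at one end of the antidiagonal, carried to the other end, and there becomes
    row 0 of the transpose, that is column 0. *)
Lemma dc_row_column D n :
  isomorphic (homology (dc_h D n.+1 0) (dc_h D n 0))
             (homology (dc_v D 0 n.+1) (dc_v D 0 n)).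
Proof.
apply: isomorphic_trans (isomorphic_sym (dc_H_row D n)) _.
apply: isomorphic_trans (dc_H_row (dc_transpose D) n).
apply: isomorphic_trans (dc_H_transpose _ _ _).
exact: (dc_H_antidiag D 0).
Qed.

(** * Functoriality and exactness of direct sums and of the bar construction *)

Section DirectSumMap.
Variables (I : choiceType) (A B : I -> zmodType) (t : forall i, {additive A i -> B i}).

Definition dsum_fmap : {additive dsum A -> dsum B} :=
  dsum_lift (fun i => (@dsum_in _ B i \o t i : {additive A i -> dsum B})).

Lemma dsum_fmap_in i (a : A i) : dsum_fmap (dsum_in a) = dsum_in (t i a).
Proof. exact: dsum_lift_in. Qed.

Lemma dsum_fmap_coord i x : dsum_coord i (dsum_fmap x) = t i (dsum_coord i x).
Proof.
pose f : {additive dsum A -> B i} := @dsum_coord _ B i \o dsum_fmap.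
pose g : {additive dsum A -> B i} := t i \o @dsum_coord _ A i.
apply: (dsum_ext (f := f) (g := g)) => j a; rewrite [LHS]/= [RHS]/= dsum_fmap_in.
have [e|ji] := pselect (j = i); first by case: i / e {f g}; rewrite !dsum_coord_in.
by rewrite !dsum_coord_in_neq // raddf0.
Qed.

(** Preimages are taken only on the finite support of [y], so that their sum is again finitely
    supported. *)
Lemma dsum_fmap_im y :
  (forall i, exists a, t i a = dsum_coord i y) -> exists x, dsum_fmap x = y.
Proof.
move=> ty; apply/im_predP; have [s us ys] := dsum_supp_seq y.
rewrite (dsum_decomp us ys); apply: rpred_sum => i _; have [a <-] := ty i.
by apply/im_predP; exists (dsum_in a); exact: dsum_fmap_in.
Qed.

End DirectSumMap.

Section SubgroupMap.
Variables (A A' : zmodType) (X : zmodClosed A) (Y : zmodClosed A').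
Variable f : {additive A -> A'}.
Hypothesis fXY : forall x, x \in X -> f x \in Y.

Definition subgrp_map_fun (u : subgrp X) : subgrp Y :=
  @exist A' (fun y => y \in Y) (f (val u)) (fXY (valP u)).
Fact subgrp_map_is_additive : zmod_morphism subgrp_map_fun.
Proof. by move=> u u'; apply: val_inj; rewrite raddfB /= !raddfB. Qed.
HB.instance Definition _ :=
  GRing.isZmodMorphism.Build (subgrp X) (subgrp Y) subgrp_map_fun
    subgrp_map_is_additive.
Definition subgrp_map : {additive subgrp X -> subgrp Y} := subgrp_map_fun.

End SubgroupMap.

Section Bar.
Context {disp : Order.disp_t} {C : porderType disp}.
Implicit Types F G H : abFunctor C.
Local Notation simplex := (@simplex disp C).

Lemma bar_ext F n (B : zmodType) (f g : {additive bar F n -> B}) :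
    (forall s (a : F (initial_vertex s)), f (bar_in F s a) = g (bar_in F s a)) ->
  f =1 g.
Proof. exact: dsum_ext. Qed.

Section BarMap.
Variables (F G : abFunctor C) (t : natTrans F G).

Definition bar_map n : {additive bar F n -> bar G n} :=
  dsum_fmap (fun s : simplex n => t (initial_vertex s)).

Lemma bar_mapE n (s : simplex n) a :
  bar_map n (bar_in F s a) = bar_in G s (t _ a).
Proof. exact: dsum_fmap_in. Qed.

Lemma bar_map_coord n (s : simplex n) (x : bar F n) :
  @dsum_coord _ (fun s : simplex n => G (initial_vertex s)) s (bar_map n x)
  = t _ (@dsum_coord _ (fun s : simplex n => F (initial_vertex s)) s x).
Proof. exact: dsum_fmap_coord. Qed.

Lemma bar_map_d n x : bar_map n (bar_d F n x) = bar_d G n (bar_map n.+1 x).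
Proof.
apply: (bar_ext (f := bar_map n \o bar_d F n) (g := bar_d G n \o bar_map n.+1)).
move=> s a; rewrite [LHS]/= [RHS]/= bar_mapE raddf_sum; apply: eq_bigr => i _.
by rewrite raddfMz !bar_faceE bar_mapE nt_nat.
Qed.

Lemma bar_map_surj n : nt_epi t -> forall y, exists x, bar_map n x = y.
Proof. by move=> tS y; apply: dsum_fmap_im => s; exact: tS. Qed.

End BarMap.

Lemma bar_map_exact F G H (t : natTrans F G) (u : natTrans G H) n :
    (forall c b, u c b = 0 <-> exists a, t c a = b) ->
  forall y, bar_map u n y = 0 <-> exists x, bar_map t n x = y.
Proof.
move=> tu y; split=> [uy0|[x <-]].
  by apply: dsum_fmap_im => s; apply/tu; rewrite -bar_map_coord uy0 raddf0.
by apply: dsumP => s; rewrite !bar_map_coord raddf0; apply/tu; eexists.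
Qed.

(** * Coning off a simplex from an object below it *)

Section Cone.

Fact scons_pred n (c : C) (s : simplex n) : (c <= initial_vertex s)%O ->
  simplex_pred [ffun i : 'I_n.+2 => if unlift ord0 i is Some j then vertex s j else c].
Proof.
move=> cs; apply/forallP => i; apply/forallP => j; apply/implyP => ij; rewrite !ffunE.
case: (unliftP ord0 i) ij => [i'|] ->; case: (unliftP ord0 j) => [j'|] -> //=.
  exact: vertex_le.
by move=> _; apply: le_trans cs _; exact: vertex_le.
Qed.

Definition scons n (c : C) (s : simplex n) (cs : (c <= initial_vertex s)%O) :
  simplex n.+1 := Sub _ (scons_pred cs).

Lemma vertex_scons0 n c (s : simplex n) cs :
  vertex (scons (c := c) (s := s) cs) ord0 = c.
Proof. by rewrite /vertex SubK ffunE unlift_none. Qed.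

Lemma vertex_sconsS n c (s : simplex n) cs i :
  vertex (scons (c := c) (s := s) cs) (lift ord0 i) = vertex s i.
Proof. by rewrite /vertex SubK ffunE liftK. Qed.

(** This vertex equals [c] only propositionally; moving coefficients by [fmap] along an inequality
    avoids a cast. *)
Lemma le_scons n c (s : simplex n) cs :
  (c <= initial_vertex (scons (c := c) (s := s) cs))%O.
Proof. by rewrite /initial_vertex vertex_scons0. Qed.

Lemma face0_scons n c (s : simplex n) cs : face ord0 (scons (c := c) (s := s) cs) = s.
Proof. by apply: simplexP => i; rewrite vertex_face vertex_sconsS. Qed.

Lemma faceS_scons n c (s : simplex n.+1) i cs cs' :
  face (lift ord0 i) (scons (c := c) (s := s) cs) = scons (c := c) (s := face i s) cs'.
Proof.
apply: simplexP => k; rewrite vertex_face.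
case: (unliftP ord0 k) => [j|] ->.
  rewrite vertex_sconsS vertex_face -(vertex_sconsS cs).
  by congr (vertex _ _); apply: val_inj; rewrite /= /bump /= !add1n; case: ltngtP; lia.
rewrite [RHS]vertex_scons0 -[RHS](vertex_scons0 cs).
by congr (vertex _ _); exact: val_inj.
Qed.

Fact pt_pred (c : C) : simplex_pred [ffun _ : 'I_1 => c].
Proof. by apply/forallP => i; apply/forallP => j; rewrite !ffunE lexx implybT. Qed.

Definition pt (c : C) : simplex 0 := Sub _ (pt_pred c).

Lemma vertex_pt c i : vertex (pt c) i = c.
Proof. by rewrite /vertex SubK ffunE. Qed.

Lemma le_pt c : (c <= initial_vertex (pt c))%O.
Proof. by rewrite /initial_vertex vertex_pt. Qed.

Lemma pt_initial (s : simplex 0) : pt (initial_vertex s) = s.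
Proof.
apply: simplexP => i; rewrite vertex_pt; congr (vertex s _).
by rewrite (ord1 i); exact: val_inj.
Qed.

(** The bottom case, outside the reach of [faceS_scons] because a 0-simplex has no face to cone
    off. *)
Lemma face1_scons c (s : simplex 0) cs :
  face (lift ord0 ord0) (scons (c := c) (s := s) cs) = pt c.
Proof.
apply: simplexP => i; rewrite vertex_face vertex_pt -[RHS](vertex_scons0 cs).
by congr (vertex _ _); rewrite (ord1 i); exact: val_inj.
Qed.

End Cone.

(** * The augmentation of the bar complex to the colimit *)

Section Augmentation.
Variable F : abFunctor C.

Definition bar_aug : {additive bar F 0 -> colim F} :=
  dsum_lift (fun s : simplex 0 =>
    (@colim_in _ _ F (initial_vertex s) : {additive F (initial_vertex s) -> colim F})).

Lemma bar_augE (s : simplex 0) a : bar_aug (bar_in F s a) = colim_in a.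
Proof. exact: dsum_lift_in. Qed.

Lemma bar_dE1 (s : simplex 1) a : bar_d F 0 (bar_in F s a) =
  bar_in F (face ord0 s) (fmap F (initial_face ord0 s) a)
  - bar_in F (face (lift ord0 ord0) s) (fmap F (initial_face _ s) a).
Proof.
by rewrite [LHS]big_ord_recl big_ord1 mulr1z mulrN1z !bar_faceE.
Qed.

Lemma bar_aug_d x : bar_aug (bar_d F 0 x) = 0.
Proof.
apply: (bar_ext (f := bar_aug \o bar_d F 0) (g := \0)) => s a.
by rewrite [LHS]/= bar_dE1 raddfB /= !bar_augE !colim_in_fmap subrr.
Qed.

(** Objects and 0-simplices are different types; [vertex_sum] and [vertex_bar] translate between
    [bar F 0] and the sum over objects that presents [colim F]. *)
Let vertex_sum : {additive bar F 0 -> dsum (fun c => F c)} :=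
  dsum_lift (fun s : simplex 0 => (@dsum_in _ (fun c => F c) (initial_vertex s)
    : {additive F (initial_vertex s) -> dsum (fun c => F c)})).

Let vertex_bar : {additive dsum (fun c => F c) -> bar F 0} :=
  dsum_lift (fun c => (bar_in F (pt c) \o fmap F (le_pt c)
    : {additive F c -> bar F 0})).

Let vertex_bar_in c (a : F c) :
  vertex_bar (dsum_in a) = bar_in F (pt c) (fmap F (le_pt c) a).
Proof. exact: dsum_lift_in. Qed.

Let vertex_sumK x : vertex_bar (vertex_sum x) = x.
Proof.
apply: (bar_ext (f := vertex_bar \o vertex_sum) (g := idfun)) => s a.
rewrite [LHS]/= [vertex_sum _]dsum_lift_in vertex_bar_in.
by rewrite [RHS]/= -[in RHS](fmap1 (lexx _) a); apply: bar_in_eq; exact: pt_initial.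
Qed.

Let bar_aug_vertex x : bar_aug x = colim_pi (vertex_sum x).
Proof.
apply: (bar_ext (f := bar_aug) (g := @colim_pi _ _ F \o vertex_sum)) => s a.
by rewrite [RHS]/= bar_augE [vertex_sum _]dsum_lift_in.
Qed.

Lemma bar_aug_surj y : exists x, bar_aug x = y.
Proof.
have [z _ ->] := cls_surj y; exists (vertex_bar z).
apply: (dsum_ext (f := bar_aug \o vertex_bar) (g := @colim_pi _ _ F)) => c a.
by rewrite [LHS]/= vertex_bar_in bar_augE colim_in_fmap.
Qed.

(** Each relation defining the colimit is the boundary of an edge, so the whole span of relations is
    carried into boundaries. *)
Lemma bar_aug_exact x : bar_aug x = 0 -> exists y, bar_d F 0 y = x.
Proof.
move/eqP; rewrite bar_aug_vertex cls_eq0 // => /span_predP.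
move=> /(_ (preim_pred vertex_bar (im_pred (bar_d F 0)))).
set G := preim_pred _ _ => xP; apply/im_predP; rewrite -(vertex_sumK x).
change (vertex_sum x \in G); apply: xP.
move=> _ /colim_relP[c [c' [h [a ->]]]]; rewrite unfold_in /= raddfB !vertex_bar_in.
have cs := le_trans h (le_pt c').
(* The edge from [c] to [c'] carrying [a]: its face 0 gives [fmap F h a] at [c'], its face 1 gives
   [a] at [c]. *)
apply/im_predP; exists (bar_in F (scons cs) (fmap F (le_scons cs) a)).
have le_face i := le_trans (le_scons cs) (initial_face i (scons cs)).
rewrite bar_dE1 !(fmap_comp _ _ (le_face _)) (fmap_comp _ _ cs).
by congr (_ - _); apply: bar_in_eq; [exact: face0_scons | exact: face1_scons].
Qed.

End Augmentation.
End Bar.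

(** * Induced functors and the contraction of their bar complex *)

Lemma bar_dE (disp : Order.disp_t) (C : porderType disp) (F : abFunctor C) n x :
  bar_d F n x = \sum_(i < n.+2) bar_face F i x *~ (-1) ^+ i.
Proof. by []. Qed.

Lemma bar_d_raddf (disp : Order.disp_t) (C : porderType disp) (F : abFunctor C)
    n (B : zmodType) (f : {additive bar F n -> B}) x :
  f (bar_d F n x) = \sum_(i < n.+2) f (bar_face F i x) *~ (-1) ^+ i.
Proof. by rewrite [LHS]raddf_sum; apply: eq_bigr => i _; rewrite raddfMz. Qed.

(** The signs behind [d c = 1 - c d] for a cone [c]: face [k + 1] of a cone is the cone on face [k],
    and the shift of index flips the sign. *)
Lemma alternating_sum_cone (V : zmodType) n (y : V) (t : 'I_n.+3 -> V)
    (u : 'I_n.+2 -> V) :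
    t ord0 = y -> (forall k, t (lift ord0 k) = u k) ->
  \sum_(i < n.+3) t i *~ (-1) ^+ i = y - \sum_(k < n.+2) u k *~ (-1) ^+ k.
Proof.
move=> t0 tS; rewrite big_ord_recl t0 mulr1z -sumrN; congr (_ + _).
by apply: eq_bigr => k _; rewrite tS exprS mulN1r mulrNz.
Qed.

Section Induced.
Context {disp : Order.disp_t} {C : porderType disp}.
Variables (I : choiceType) (w : I -> C) (A : I -> zmodType).
Local Notation simplex := (@simplex disp C).

(* The sum of the [A i] with [w i <= c], that is the left Kan extension of [A]
   along [w]; all its transition maps are inclusions of subgroups of [dsum A]. *)
Definition ind_sub (c : C) : zmodClosed (dsum A) := supported (fun i => (w i <= c)%O).

Fact ind_sub_le c c' : (c <= c')%O -> {subset ind_sub c <= ind_sub c'}.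
Proof. by move=> cc' x /supportedP xP; apply/supportedP => i /xP /le_trans; apply. Qed.

Definition ind_fmap c c' (h : (c <= c')%O) :
    {additive subgrp (ind_sub c) -> subgrp (ind_sub c')} :=
  subgrp_map (f := idfun) (ind_sub_le h).

Fact ind_fmap1 c (h : (c <= c)%O) u : ind_fmap h u = u.
Proof. exact: val_inj. Qed.

Fact ind_fmap_comp c c' c'' (h : (c <= c')%O) (h' : (c' <= c'')%O)
    (h'' : (c <= c'')%O) u :
  ind_fmap h' (ind_fmap h u) = ind_fmap h'' u.
Proof. exact: val_inj. Qed.

Definition induced : abFunctor C := AbFunctor ind_fmap1 ind_fmap_comp.

Definition ind_in_fun i c (h : (w i <= c)%O) (a : A i) : subgrp (ind_sub c) :=
  @exist _ (fun x => x \in ind_sub c) (dsum_in a)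
    (@supported_in _ A (fun i => (w i <= c)%O) i a h).
Fact ind_in_is_additive i c h : zmod_morphism (@ind_in_fun i c h).
Proof. by move=> a b; apply: val_inj; rewrite /= !raddfB. Qed.
HB.instance Definition _ i c h :=
  GRing.isZmodMorphism.Build (A i) (subgrp (ind_sub c)) (@ind_in_fun i c h)
    (@ind_in_is_additive i c h).
Definition ind_in i c (h : (w i <= c)%O) : {additive A i -> induced c} :=
  (@ind_in_fun i c h : {additive A i -> subgrp (ind_sub c)}).

Lemma fmap_ind_in i c c' (h : (w i <= c)%O) (h' : (c <= c')%O) h'' a :
  fmap induced h' (ind_in h a) = ind_in (i := i) h'' a.
Proof. exact: (@val_inj _ _ (subgrp (ind_sub c'))). Qed.

Lemma ind_ext c (B : zmodType) (f g : {additive induced c -> B}) :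
  (forall i (h : (w i <= c)%O) a, f (ind_in h a) = g (ind_in h a)) -> f =1 g.
Proof.
move=> fg x; pose v : {additive subgrp (ind_sub c) -> dsum A} := val.
(* [supported_ind] speaks of subgroups of [dsum A], whereas [f] and [g] live on a subgroup of it;
   hence the kernel of [f \- g] is pushed into [dsum A]. *)
pose E : {additive subgrp (ker_pred (f \- g)) -> dsum A} := v \o val.
have: v x \in im_pred E.
  apply: (@supported_ind _ _ (fun i => (w i <= c)%O)) (valP x) => i a h.
  have ha : ind_in h a \in ker_pred (f \- g) by rewrite inE /= fg subrr.
  by apply/im_predP; exists (@exist _ (fun y => y \in ker_pred (f \- g)) _ ha).
case/im_predP=> y /val_inj <-; apply/eqP; rewrite -subr_eq0; exact: (valP y).
Qed.

Section Rec.
Variables (c : C) (B : zmodType) (g : forall i, (w i <= c)%O -> {additive A i -> B}).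

(** [dsum_lift] wants a map for every [i], while [g i] needs [w i <= c]; elements of [induced c]
    vanish at the other [i], which are sent to 0. *)
Definition ind_rec : {additive induced c -> B} :=
  dsum_lift (fun i => if pselect (w i <= c)%O is left h then g h else \0) \o val.

Lemma ind_recE i (h : (w i <= c)%O) a : ind_rec (ind_in h a) = g h a.
Proof.
rewrite [LHS]dsum_lift_in; case: pselect => // h'.
by rewrite (bool_irrelevance h h').
Qed.

End Rec.

Section Contraction.
Variable n : nat.

(** The apex depends on the summand: [A i] occurs at [s] only if [w i] is below the initial vertex,
    so [w i] can be put in front of [s]. *)
Definition contr_gen (s : simplex n) i (h : (w i <= initial_vertex s)%O) :
    {additive A i -> bar induced n.+1} :=
  bar_in induced (scons h) \o ind_in (le_scons h).

Definition contr : {additive bar induced n -> bar induced n.+1} :=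
  dsum_lift (fun s => ind_rec (@contr_gen s)).

Lemma contrE (s : simplex n) i (h : (w i <= initial_vertex s)%O) a :
  contr (bar_in induced s (ind_in h a))
  = bar_in induced (scons h) (ind_in (le_scons h) a).
Proof. by rewrite [LHS]dsum_lift_in ind_recE. Qed.

End Contraction.

Lemma bar_in_ind_eq n (s t : simplex n) i (hs : (w i <= initial_vertex s)%O)
    (ht : (w i <= initial_vertex t)%O) a :
  s = t -> bar_in induced s (ind_in hs a) = bar_in induced t (ind_in ht a).
Proof. by move=> st; case: t / st ht => ht; rewrite (bool_irrelevance hs ht). Qed.

Lemma bar_ind_ext n (B : zmodType) (f g : {additive bar induced n -> B}) :
    (forall (s : simplex n) i (h : (w i <= initial_vertex s)%O) a,
      f (bar_in induced s (ind_in h a)) = g (bar_in induced s (ind_in h a))) ->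
  f =1 g.
Proof.
move=> fg; apply: bar_ext => s u.
pose b : {additive induced (initial_vertex s) -> bar induced n} := bar_in induced s.
by change ((f \o b) u = (g \o b) u); apply: ind_ext => i h a; exact: fg.
Qed.

Lemma bar_face_ind_in n k (s : simplex n.+1) i (h : (w i <= initial_vertex s)%O)
    (h' : (w i <= initial_vertex (face k s))%O) a :
  bar_face induced k (bar_in induced s (ind_in h a))
  = bar_in induced (face k s) (ind_in h' a).
Proof. by rewrite bar_faceE (fmap_ind_in _ _ h'). Qed.

Lemma bar_face0_contr n x : bar_face induced ord0 (contr n x) = x.
Proof.
pose f : {additive bar induced n -> bar induced n} := bar_face induced ord0 \o contr n.
change (f x = idfun x); apply: bar_ind_ext => s i h a.
have h0 := le_trans (le_scons h) (initial_face ord0 (scons h)).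
apply: etrans (congr1 (bar_face induced ord0) (contrE h a)) _.
by apply: etrans (bar_face_ind_in _ h0 a) _; apply: bar_in_ind_eq; exact: face0_scons.
Qed.

Lemma bar_faceS_contr n k x :
  bar_face induced (lift ord0 k) (contr n.+1 x) = contr n (bar_face induced k x).
Proof.
pose f : {additive bar induced n.+1 -> bar induced n.+1} :=
  bar_face induced (lift ord0 k) \o contr n.+1.
pose g : {additive bar induced n.+1 -> bar induced n.+1} :=
  contr n \o bar_face induced k.
change (f x = g x); apply: bar_ind_ext => s i h a.
have hS := le_trans (le_scons h) (initial_face (lift ord0 k) (scons h)).
have hk := le_trans h (initial_face k s).
apply: etrans (congr1 (bar_face induced (lift ord0 k)) (contrE h a)) _.
apply: etrans (bar_face_ind_in _ hS a) _; apply/esym.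
apply: etrans (congr1 (contr n) (bar_face_ind_in h hk a)) _.
by apply: etrans (contrE hk a) _; apply: bar_in_ind_eq; rewrite faceS_scons.
Qed.

(** Face 0 undoes the cone and the other faces commute with it, which makes [contr] a contracting
    homotopy in positive degrees. *)
Lemma contr_d n (x : bar induced n.+1) :
  bar_d induced n.+1 (contr n.+1 x) = x - contr n (bar_d induced n x).
Proof.
have cE := bar_d_raddf (contr n) x.
apply: etrans (bar_dE (contr n.+1 x)) _.
apply: (etrans _ (congr1 (fun z => x - z) (esym cE))).
exact: alternating_sum_cone (bar_face0_contr x) (fun k => bar_faceS_contr k x).
Qed.

Lemma contr_cycle n (x : bar induced n.+1) :
  bar_d induced n x = 0 -> bar_d induced n.+1 (contr n.+1 x) = x.
Proof.
move=> dx0; have cE := etrans (congr1 (contr n) dx0) (raddf0 (contr n)).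
by apply: etrans (contr_d x) _; rewrite cE subr0.
Qed.

End Induced.

(** * Free functors, acyclicity of projectives, existence of projective resolutions *)

Section Acyclic.
Context {disp : Order.disp_t} {C : porderType disp}.
Implicit Types F G P : abFunctor C.

Definition ind_lift (I : choiceType) (w : I -> C) (A : I -> zmodType) F
    (f : forall i, {additive A i -> F (w i)}) : natTrans (induced w A) F.
Proof.
exists (fun c => ind_rec (fun i (h : (w i <= c)%O) => fmap F h \o f i)) => c c' h a.
set r := ind_rec _; set r' := ind_rec _.
apply: (ind_ext (f := r \o fmap (induced w A) h) (g := fmap F h \o r')) => i hi b.
have h' := le_trans hi h.
change (r (fmap (induced w A) h (ind_in A hi b)) = fmap F h (r' (ind_in A hi b))).
by rewrite (fmap_ind_in _ _ h') !ind_recE /= (fmap_comp _ _ h').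
Defined.

Lemma ind_liftE (I : choiceType) (w : I -> C) (A : I -> zmodType) F
    (f : forall i, {additive A i -> F (w i)}) i c (h : (w i <= c)%O) a :
  ind_lift f c (ind_in A h a) = fmap F h (f i a).
Proof. exact: ind_recE. Qed.

Definition intmul_add (V : zmodType) (x : V) : {additive int -> V} :=
  HB.pack_for {additive int -> V} ( *~%R x)
    (GRing.isZmodMorphism.Build int V ( *~%R x) (mulrzBr x)).

(** The direct sum of the linearised representable functors of the [w i]. *)
Definition free (I : choiceType) (w : I -> C) : abFunctor C := induced w (fun=> int).

(** By the Yoneda lemma a transformation out of [free w] amounts to the images of the generators
    [one i], and these lift one at a time. *)
Lemma free_projective (I : choiceType) (w : I -> C) : projective (free w).
Proof.
move=> F G t g t_epi; pose one i : free w (w i) := ind_in (fun=> int) (lexx (w i)) 1.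
pose x i := projT1 (cid (t_epi (w i) (g (w i) (one i)))).
have xE i : t (w i) (x i) = g (w i) (one i) by rewrite /x; case: cid.
pose f i := intmul_add (x i).
exists (ind_lift f) => c u.
change ((t c \o ind_lift f c) u = g c u); apply: ind_ext => i h z.
pose e := ind_in (fun=> int) h.
change (t c (ind_lift f c (e z)) = g c (e z)); rewrite ind_liftE.
have fE : f i z = x i *~ z by [].
rewrite fE raddfMz raddfMz nt_nat xE -nt_nat (fmap_ind_in _ _ h) -raddfMz -raddfMz.
by rewrite intz.
Qed.

Definition cover_ob F : choiceType := {c : C & F c}.

Definition cover F : abFunctor C := free (fun x : cover_ob F => tag x).

Definition cover_map F : natTrans (cover F) F :=
  ind_lift (fun x : cover_ob F => intmul_add (tagged x)).

Lemma cover_epi F : nt_epi (cover_map F).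
Proof.
move=> c b; pose i : cover_ob F := Tagged (fun c => F c) b.
exists (ind_in (fun=> int) (lexx c : (tag i <= c)%O) 1).
by rewrite ind_liftE fmap1 /= mulr1z.
Qed.

Definition nt_id F : natTrans F F :=
  @NatTrans _ _ F F (fun=> idfun) (fun _ _ _ _ => erefl).

(* [P] is a direct summand of its free cover, whose bar complex is contractible. *)
Lemma bar_projective_exact P n (x : bar P n.+1) : projective P ->
  bar_d P n x = 0 -> exists y, bar_d P n.+1 y = x.
Proof.
(* Lifting the identity of [P] through its cover gives a section [s]; a primitive found in the cover
   is then mapped back to [P]. *)
move=> Pproj dx0; have [s sE] := Pproj _ _ _ (nt_id P) (@cover_epi P).
pose z := bar_map s n.+1 x; have dz0 : bar_d (cover P) n z = 0.
  by rewrite -bar_map_d dx0 raddf0.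
have zE := contr_cycle dz0.
exists (bar_map (cover_map P) n.+2
  (contr (fun i : cover_ob P => tag i) (fun=> int) n.+1 z)).
apply: etrans (esym (bar_map_d _ _)) _.
apply: etrans (congr1 (bar_map (cover_map P) n.+1) zE) _.
by apply: dsumP => t; rewrite !bar_map_coord sE.
Qed.

Section Kernel.
Variables (F G : abFunctor C) (t : natTrans F G).

Fact ker_fmap_sub c c' (h : (c <= c')%O) x :
  x \in ker_pred (t c) -> fmap F h x \in ker_pred (t c').
Proof. by rewrite !inE nt_nat => /eqP ->; rewrite raddf0. Qed.

Definition ker_functor : abFunctor C.
Proof.
exists (fun c => subgrp (ker_pred (t c)))
  (fun c c' h => subgrp_map (@ker_fmap_sub c c' h)).
  by move=> c h a; apply: val_inj; exact: fmap1.
by move=> c c' c'' h h' h'' a; apply: val_inj; exact: fmap_comp.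
Defined.

Definition ker_incl : natTrans ker_functor F.
Proof. by exists (fun c => (val : {additive subgrp (ker_pred (t c)) -> F c})). Defined.

End Kernel.

Definition nt_comp F G H (t : natTrans F G) (u : natTrans G H) : natTrans F H.
Proof. by exists (fun c => u c \o t c) => c c' h a; rewrite /= !nt_nat. Defined.

Fixpoint syzygy F n : abFunctor C :=
  if n is m.+1 then ker_functor (cover_map (syzygy F m)) else F.

(** The short exact sequences of a syzygy, its cover and the next syzygy are spliced: [d n] is the
    cover map followed by the inclusion of the kernel. *)
Lemma proj_resolution_exists F : inhabited (proj_resolution F).
Proof.
pose d n : natTrans (cover (syzygy F n.+1)) (cover (syzygy F n)) :=
  nt_comp (cover_map (syzygy F n.+1)) (ker_incl (cover_map (syzygy F n))).
pose v n c (u : subgrp (ker_pred (cover_map (syzygy F n) c))) := val u.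
have dE n c a : cover_map (syzygy F n) c a = 0 <-> exists b, d n c b = a.
  split=> [a0|[b <-]]; last first.
    by apply/eqP; exact: (valP (cover_map (syzygy F n.+1) c b)).
  have aK : a \in ker_pred (cover_map (syzygy F n) c) by rewrite inE a0.
  have [b bE] := @cover_epi (syzygy F n.+1) c
    (@exist _ (fun a => a \in ker_pred _) _ aK).
  by exists b; exact: (congr1 (@v n c) bE).
(* The inclusion of the kernel is injective, so [d n] vanishes exactly where the cover map does. *)
have d0 n c a : d n c a = 0 <-> cover_map (syzygy F n.+1) c a = 0.
  split=> a0; first exact: (@val_inj _ _ (subgrp _) _ 0 a0).
  exact: (congr1 (@v n c) a0).
constructor; exists (fun n => cover (syzygy F n)) d (cover_map F).
- by move=> n; exact: free_projective.
- exact: cover_epi.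
- exact: dE.
- by move=> n c a; rewrite d0; exact: dE.
Qed.

End Acyclic.

(** * Comparison of the bar complex with a projective resolution *)

Section ChainHomology.
Variable X : chain.

(** The zero group below [X 0] matches the corner of the double complex, whose edges are indexed by
    natural numbers. *)
Definition chain_out_ob (n : nat) : zmodType := if n is m.+1 then X m else 'rV[int]_0.
Definition chain_out n : {additive X n -> chain_out_ob n} :=
  if n is m.+1 then ch_d X m else \0.

Lemma dg_H_chain (n : nat) :
  isomorphic (dg_H (dg_of_chain X) n) (homology (ch_d X n) (chain_out n)).
Proof.
have e k : k.+1%:Z + sgv Homol = k by rewrite -addn1 PoszD addrK.
rewrite -(chdg_dE X (e n)); case: n => [|n].
  have e0 : 0%:Z + sgv Homol = Negz 0 by [].
  exact: (@homology_degree _ (dg_of_chain X) _ _ _ _ _ _ _ _ (e 0%N) e0 erefl).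
rewrite /chain_out -(chdg_dE X (e n)).
exact: (@homology_degree _ (dg_of_chain X) _ _ _ _ _ _ _ _ (e n.+1) (e n) erefl).
Qed.

Lemma dg_H_chain_neg k (y : dg_H (dg_of_chain X) (Negz k)) : y = 0.
Proof.
have [x xZ ->] := cls_surj y; apply/eqP; rewrite cls_eq0 //.
by have -> : x = 0 by [exact: (@thinmx0 int 1)]; rewrite rpred0.
Qed.

End ChainHomology.

Lemma isomorphic_trivial (A B : zmodType) :
  (forall x : A, x = 0) -> (forall y : B, y = 0) -> isomorphic A B.
Proof.
by move=> A0 B0; exists \0; exists \0 => x; [exact/esym/A0|exact/esym/B0].
Qed.

Section Balancing.
Context {disp : Order.disp_t} {C : porderType disp}.
Variables (F : abFunctor C) (P : proj_resolution F).

(* The corner would be the colimit of [F]; [0] there makes degree [0] of both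
   edge complexes consist of cycles. *)
Definition bal_ob (p q : nat) : zmodType :=
  match p, q with
  | 0, 0 => 'rV[int]_0
  | 0, q.+1 => colim (P q)
  | p.+1, 0 => bar F p
  | p.+1, q.+1 => bar (P q) p
  end.

Definition bal_h p q : {additive bal_ob p.+1 q -> bal_ob p q} :=
  match p, q with
  | 0, 0 => \0
  | 0, q.+1 => bar_aug (P q)
  | p.+1, 0 => bar_d F p
  | p.+1, q.+1 => bar_d (P q) p
  end.

Definition bal_v p q : {additive bal_ob p q.+1 -> bal_ob p q} :=
  match p, q with
  | 0, 0 => \0
  | 0, q.+1 => colim_map (res_d P q)
  | p.+1, 0 => bar_map (res_aug P) p
  | p.+1, q.+1 => bar_map (res_d P q) p
  end.

Lemma bar_aug_map (G H : abFunctor C) (t : natTrans G H) x :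
  bar_aug H (bar_map t 0 x) = colim_map t (bar_aug G x).
Proof.
change ((bar_aug H \o bar_map t 0) x = (colim_map t \o bar_aug G) x).
apply: bar_ext => s a; rewrite [LHS]/= [RHS]/=.
by rewrite bar_mapE !bar_augE colim_mapE.
Qed.

Fact bal_hh p q x : bal_h p q (bal_h p.+1 q x) = 0.
Proof.
case: p q x => [|p] [|q] x; [by []|exact: bar_aug_d|exact: bar_dd|exact: bar_dd].
Qed.

Fact bal_vv p q x : bal_v p q (bal_v p q.+1 x) = 0.
Proof.
case: p q x => [|p] [|q] x; [by []|exact: colim_res_dd| |].
  exact (iffRL (bar_map_exact (n := p) (@res_exact0 _ _ _ P) _) (ex_intro _ x erefl)).
exact (iffRL (bar_map_exact (n := p) (@res_exactS _ _ _ P q) _) (ex_intro _ x erefl)).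
Qed.

Fact bal_hv p q x : bal_h p q (bal_v p.+1 q x) = bal_v p q (bal_h p q.+1 x).
Proof.
case: p q x => [|p] [|q] x; [by []|exact: bar_aug_map| |];
  exact/esym/bar_map_d.
Qed.

Fact bal_h_exact p q x : bal_h p q.+1 x = 0 -> exists y, bal_h p.+1 q.+1 y = x.
Proof.
case: p x => [|p] x; first exact: bar_aug_exact.
exact/bar_projective_exact/res_proj.
Qed.

Fact bal_v_exact p q x : bal_v p.+1 q x = 0 -> exists y, bal_v p.+1 q.+1 y = x.
Proof.
case: q x => [|q] x; first exact: (bar_map_exact (n := p) (@res_exact0 _ _ _ P) x).1.
exact: (bar_map_exact (n := p) (@res_exactS _ _ _ P q) x).1.
Qed.

Definition bal_dc : resolving_dc :=
  ResolvingDc bal_hh bal_vv bal_hv bal_h_exact bal_v_exact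
    (fun q => @bar_aug_surj _ _ (P q))
    (fun p => @bar_map_surj _ _ _ _ (res_aug P) p (@res_aug_epi _ _ _ P)).

Lemma bar_homology_colim_res (n : int) :
  isomorphic (dg_H (bar_dg F) n) (dg_H (dg_of_chain (colim_res P)) n).
Proof.
case: n => n; last by apply: isomorphic_trivial => y; exact: dg_H_chain_neg.
apply: isomorphic_trans (dg_H_chain _ _) _.
apply: isomorphic_trans (isomorphic_sym (dg_H_chain _ _)).
(* Index [n.+1] of row 0 and of column 0 holds degree [n] of [bar F] and of [colim_res P]. The case
   split lets the outgoing maps compute, those of degree 0 being zero. *)
by have := dc_row_column bal_dc n; case: n.
Qed.

End Balancing.

Theorem propositionC (disp : Order.disp_t) (C : porderType disp)
    (deg : C -> int) (deg_dec : decreasing_degree deg) (F : abFunctor C) :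
  exists E : spectral_sequence Cohom,
  [/\ ss_associated (regrade_fil (final_filtration deg_dec F)) E,
      forall n : int,
        is_left_derived_colim F n (dg_H (regrade (bar_dg F)) (- n))
    & forall p : int,
        exists E' : spectral_sequence Homol,
          ss_associated
            (gr_fil (final_filtration deg_dec F) p
               (initial_filtration deg_dec F)) E' /\
          forall n q : int, p + q = - n ->
            isomorphic (dg_H (gr (final_filtration deg_dec F) p) n)
                       (E 1%N (p, q))].
Proof.
have [E EL] := ss_associated_exists (regrade_fil (final_filtration deg_dec F)).
exists E; split=> // [n|p].
  split=> [|P]; first exact: proj_resolution_exists.
  apply: isomorphic_trans (bar_homology_colim_res P n).
  (* Degree [- n] of the regraded bar complex is [C_n]. *)
  exact: homology_regrade.
have [E' EL'] := ss_associated_exists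
  (gr_fil (final_filtration deg_dec F) p (initial_filtration deg_dec F)).
exists E'; split=> // n q; exact: page1_gr.
Qed.
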